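(* Consider the Gaussian robust ranking and selection model of the context, with true means satisfying the uniqueness assumptions stated there, and suppose that replications are allocated sequentially according to the RAODA policy defined in the context. Let $\langle 1\rangle=\arg\max_{i}\min_{d}\mu_{i,d}$ be the true best alternative and let $\langle 1\rangle_t$ be the posterior best alternative after $t$ replications. Then $$\lim_{t\to\infty}\langle 1\rangle_t=\langle 1\rangle\quad\text{almost surely.}$$
   Context: There are $k\ge2$ alternatives, each with $m$ scenarios. Replications of pair $(i,d)\in\{1,\dots,k\}\times\{1,\dots,m\}$ are i.i.d. $N(\mu_{i,d},\sigma_{i,d}^2)$, with $\mu_{i,d}$ unknown and $\sigma_{i,d}^2>0$ known, independent across pairs. Uniqueness assumptions: for each $i$ there is a scenario $d_i$ with $\mu_{i,d_i}<\mu_{i,d}$ for all $d\ne d_i$; and there is an alternative $\langle 1\rangle$ with $\mu_{\langle1\rangle,d_{\langle1\rangle}}>\mu_{j,d_j}$ for all $j\ne\langle1\rangle$. Priors are $\mu_{i,d}\sim N(\mu_{i,d}^{(0)},(\sigma_{i,d}^{(0)})^2)$, independent. Let $t_{i,d}$ be the number of replications given to $(i,d)$ among the first $t$, and $\bar X_{i,d}^{(t)}$ their sample mean. The posterior of $\mu_{i,d}$ is $N(\mu_{i,d}^{(t)},(\sigma_{i,d}^{(t)})^2)$, with $$(\sigma_{i,d}^{(t)})^2=\left(\frac1{(\sigma_{i,d}^{(0)})^2}+\frac{t_{i,d}}{\sigma_{i,d}^2}\right)^{-1},\qquad \mu_{i,d}^{(t)}=(\sigma_{i,d}^{(t)})^2\left(\frac{\mu_{i,d}^{(0)}}{(\sigma_{i,d}^{(0)})^2}+\frac{t_{i,d}\bar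 X_{i,d}^{(t)}}{\sigma_{i,d}^2}\right).$$ The procedure starts by giving $n_0\ge1$ replications to every pair. At time $t$, let $d_i^{t}=\arg\min_{d}\mu_{i,d}^{(t)}$ be the posterior worst-case scenario of alternative $i$, and let $\langle1\rangle_t=\arg\max_i\mu_{i,d_i^{t}}^{(t)}$ be the posterior best alternative; write $b=\langle 1\rangle_t$. Let $\mathcal{F}_t$ denote the information (prior and observed data) at time $t$. For a pair $(j,s)$, let $(\sigma_{j,s}^{(t+1)})^2=\left(1/(\sigma_{j,s}^{(0)})^2+(t_{j,s}+1)/\sigma_{j,s}^2\right)^{-1}$ be the posterior variance if $(j,s)$ receives one more replication. Define the one-step-ahead values (a minimum over an empty set is $+\infty$): for $s\in\{1,\dots,m\}$, $$V_t(\mathcal{F}_t;(b,s))=\min\left\{\min_{i\ne b}\frac{(\mu_{b,s}^{(t)}-\mu_{i,d_i^{t}}^{(t)})^2}{(\sigma_{b,s}^{(t+1)})^2+(\sigma_{i,d_i^{t}}^{(t)})^2},\ \min_{l\ne s,\ i\ne b}\frac{(\mu_{b,l}^{(t)}-\mu_{i,d_i^{t}}^{(t)})^2}{(\sigma_{b,l}^{(t)})^2+(\sigma_{i,d_i^{t}}^{(t)})^2}\right\},$$ and for $j\ne b$, $s=d_j^{t}$, $$V_t(\mathcal{F}_t;(j,s))=\min\left\{\min_{1\le l\le m}\frac{(\mu_{b,l}^{(t)}-\mu_{j,s}^{(t)})^2}{(\sigma_{b,l}^{(t)})^2+(\sigma_{j,s}^{(t+1)})^2},\ \min_{1\le l\le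 m,\ i\notin\{b,j\}}\frac{(\mu_{b,l}^{(t)}-\mu_{i,d_i^{t}}^{(t)})^2}{(\sigma_{b,l}^{(t)})^2+(\sigma_{i,d_i^{t}}^{(t)})^2}\right\}.$$ The RAODA policy gives replication $t+1$ to a pair $(j,s)$ maximizing $V_t(\mathcal{F}_t;(j,s))$ over the pairs $(b,1),\dots,(b,m)$ and $(j,d_j^{t})$, $j\ne b$. The budget is unlimited as $t\to\infty$. *)

(* Defs.v *)
From HB Require Import structures.
From mathcomp Require Import all_boot all_order all_algebra.
From mathcomp Require Import all_classical all_reals all_analysis.

Set Implicit Arguments.
Unset Strict Implicit.
Unset Printing Implicit Defensive.

Import Order.TTheory GRing.Theory Num.Theory.
Import numFieldNormedType.Exports.

Local Open Scope classical_set_scope.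
Local Open Scope ring_scope.

Section Independence.
Context d (T : measurableType d) (R : realType) (P : probability T R).
Context (I : eqType) (X : I -> {RV P >-> R}).

(* The event that X j lies in B j for every j in J. *)
Definition cylinder (J : seq I) (B : I -> set R) : set T :=
  [set w | forall j, j \in J -> B j (X j w)].

Definition mutually_independent : Prop :=
  forall (J : seq I) (B : I -> set R),
    uniq J -> (forall j, measurable (B j)) ->
    P (cylinder J B) = (\prod_(j <- J) P (X j @^-1` B j))%E.

(* Cylinders form a pi-system, so this is independence of the sigma-algebra
   generated by the whole family X from the events in G. *)
Definition independent_of (G : set (set T)) : Prop :=
  forall (E : set T) (J : seq I) (B : I -> set R),
    G E -> (forall j, measurable (B j)) ->
    P (E `&` cylinder J B) = (P E * P (cylinder J B))%E.

End Independence.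

Section Sampling.
Context (T : Type) (R : realType) (k m : nat).
(* X ((i, d), n) w is the n-th replication (from n = 0) of the pair (i, d);
   A t w is the pair that receives replication t + 1. *)
Context (X : 'I_k * 'I_m * nat -> T -> R).
Context (A : nat -> T -> 'I_k * 'I_m).

(* t_{i,d}, the number of the first t replications given to p = (i, d) *)
Definition count_rep (t : nat) (w : T) (p : 'I_k * 'I_m) : nat :=
  (\sum_(0 <= u < t) (A u w == p))%N.

Definition sample_mean (t : nat) (w : T) (p : 'I_k * 'I_m) : R :=
  (\sum_(0 <= n < count_rep t w p) X (p, n) w) / (count_rep t w p)%:R.

(* The outcome of replication t + 1. *)
Definition observation (t : nat) (w : T) : R :=
  X (A t w, count_rep t w (A t w)) w.

(* The sigma-algebra F_t of the data observed up to time t, enlarged by a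
   class G of events exogenous to the replications, which may be used to
   break ties at random; G may be the trivial sigma-algebra. *)
Definition information (G : set (set T)) (t : nat) : set (set T) :=
  <<s G `|`
      [set E | exists u p, (u < t)%N /\ E = A u @^-1` [set p]] `|`
      [set E | exists u (B : set R),
        [/\ (u < t)%N, measurable B & E = observation u @^-1` B]] >>.

(* The allocation decision for replication t + 1 uses only the information
   available at time t. *)
Definition nonanticipating (G : set (set T)) : Prop :=
  forall t p, information G t (A t @^-1` [set p]).

(* mu0, sigma0: prior means and standard deviations; sigma: standard
   deviations of the replications. *)
Context (mu0 sigma0 sigma : 'I_k -> 'I_m -> R).

Definition var_after (n : nat) (i : 'I_k) (d : 'I_m) : R :=
  ((sigma0 i d ^+ 2)^-1 + n%:R / sigma i d ^+ 2)^-1.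

Definition post_var (t : nat) (w : T) (i : 'I_k) (d : 'I_m) : R :=
  var_after (count_rep t w (i, d)) i d.

(* The posterior variance if (i, d) receives one more replication. *)
Definition next_var (t : nat) (w : T) (i : 'I_k) (d : 'I_m) : R :=
  var_after (count_rep t w (i, d)).+1 i d.

Definition post_mean (t : nat) (w : T) (i : 'I_k) (d : 'I_m) : R :=
  post_var t w i d *
  (mu0 i d / sigma0 i d ^+ 2 +
   (count_rep t w (i, d))%:R * sample_mean t w (i, d) / sigma i d ^+ 2).

End Sampling.

(* One-step-ahead values at a given time: M, S, S' are the posterior means, the
   posterior variances and the posterior variances after one more replication,
   D i is the posterior worst-case scenario of i and b the posterior best
   alternative. *)
Section Value.
Context (R : realType) (k m : nat).
Context (M S S' : 'I_k -> 'I_m -> R) (D : 'I_k -> 'I_m) (b : 'I_k).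

Definition sep (x y v w : R) : \bar R := ((x - y) ^+ 2 / (v + w))%:E.

Definition value_best (s : 'I_m) : \bar R :=
  mine
    (\big[mine/+oo%E]_(i | i != b)
       sep (M b s) (M i (D i)) (S' b s) (S i (D i)))
    (\big[mine/+oo%E]_(l | l != s) \big[mine/+oo%E]_(i | i != b)
       sep (M b l) (M i (D i)) (S b l) (S i (D i))).

Definition value_other (j : 'I_k) (s : 'I_m) : \bar R :=
  mine
    (\big[mine/+oo%E]_l sep (M b l) (M j s) (S b l) (S' j s))
    (\big[mine/+oo%E]_l \big[mine/+oo%E]_(i | (i != b) && (i != j))
       sep (M b l) (M i (D i)) (S b l) (S i (D i))).

Definition value (p : 'I_k * 'I_m) : \bar R :=
  if p.1 == b then value_best p.2 else value_other p.1 p.2.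

Definition candidate (p : 'I_k * 'I_m) : bool :=
  (p.1 == b) || (p.2 == D p.1).

Definition raoda_choice (p : 'I_k * 'I_m) : Prop :=
  candidate p /\ forall q, candidate q -> (value q <= value p)%E.

End Value.

(* Main.v *)
Require Import Defs.
From HB Require Import structures.
From mathcomp Require Import all_boot all_order all_algebra.
From mathcomp Require Import all_classical all_reals all_analysis.
From mathcomp Require Import measurable_realfun zify ring lra.
Import Order.TTheory GRing.Theory Num.Theory.
Import numFieldNormedType.Exports.

Set Implicit Arguments.
Unset Strict Implicit.
Unset Printing Implicit Defensive.

Local Open Scope classical_set_scope.
Local Open Scope ring_scope.

(** The proof separates what happens along one path from the probability needed
to know that almost every path is of the required kind.

Fix a path. A pair that receives finitely many replications is called stopped:
its posterior mean and variance freeze. For any other pair the posterior mean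
tends to the true mean and the posterior variance to zero. At time t, an edge
joins a scenario of the posterior best alternative to the posterior worst
scenario of another alternative, and its separation is the squared difference
of the two posterior means over the sum of the two posterior variances. The
value of a candidate is the least separation of an edge when the candidate is
granted one more replication; the policy maximizes this minimum
([raoda_choice_edge]).

Suppose that the posterior best alternative is wrong at a late time. Some edge
has a stopped end, since otherwise all the posterior means that decide the
comparison with the true best alternative would be close to the truth
([stopped_edge]). Among the edges with a stopped end, consider the smallest one
in the limit. One more replication of its stopped end would improve it by a
fixed amount, while a replication of an unstopped pair improves nothing in the
limit; as stopped pairs are no longer chosen, the minimum must be attained
elsewhere, at an edge whose two ends are unstopped and whose separation stays
bounded ([key_edge]). Variances vanish at both ends, so that the two true means
coincide. Hence there is a set of tied pairs, unstopped and with the same true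
mean, that meets several alternatives.

The uniqueness assumptions do not forbid such ties, but the randomness of the
replications does, in two ways. First, almost surely the limits of posterior
means and variances satisfy no accidental equation ([ae_untied]), which makes
the comparisons above strict. Second, at infinitely many scales N, the last
tied pair q to reach N replications is pushed by its next N replications to a
distance of order 1 / sqrt N from the other tied pairs, which stay closer to
the truth from then on ([push_recurrence]). Indeed the policy does not look
ahead, so the event that q is last is independent of these N replications, and
the probability of the push is bounded below whatever happened before; the
quietness of the other pairs follows from Ville's inequality ([ville]). The push
goes down if q belongs to the true best alternative and up otherwise. Once
pushed, q is far from the other tied pairs, in units of their standard
deviations, and the policy never samples it again ([pushed_not_sampled]). This
contradicts that q is unstopped. *)

(** * Gaussian exponential moments and tails *)

Section NormalMGF.
Context (R : realType).
Implicit Types (m s l : R) (f : measurableTypeR R -> \bar R).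

(** The normal law is dominated by the Lebesgue measure, and its density agrees
almost everywhere with the Radon-Nikodym derivative that changes variables. *)
Lemma ge0_integral_normal_prob m s f : s != 0 ->
  measurable_fun setT f -> (forall x, 0 <= f x)%E ->
  (\int[normal_prob m s]_x f x =
   \int[lebesgue_measure]_x (f x * (normal_pdf m s x)%:E))%E.
Proof.
move=> s0 mf f0.
have dom := normal_prob_dominates m s.
rewrite -(Radon_Nikodym_SigmaFinite.change_of_variables dom f0 measurableT mf).
apply: ae_eq_integral => //.
- apply: emeasurable_funM => //.
  exact: measurable_int (Radon_Nikodym_SigmaFinite.f_integrable _).
- apply: emeasurable_funM => //; apply/measurable_EFinP.
  exact: measurable_normal_pdf.
- apply: ae_eqe_mul2l; apply: integral_ae_eq => //.
  + exact: Radon_Nikodym_SigmaFinite.f_integrable.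
  + by apply/measurable_EFinP; exact: measurable_normal_pdf.
  + by move=> E _ mE; rewrite -Radon_Nikodym_SigmaFinite.f_integral.
Qed.

(** Completing the square turns the exponential weight into a shift of the mean
by [l * s ^+ 2]. *)
Lemma normal_mgf m s l : s != 0 ->
  (\int[normal_prob m s]_x (expR (l * (x - m)))%:E =
   (expR (l ^+ 2 * s ^+ 2 / 2))%:E)%E.
Proof.
move=> s0; rewrite ge0_integral_normal_prob//; last first.
  apply/measurable_EFinP; apply: measurableT_comp => //.
  by apply: measurable_funM => //; exact: measurable_funB.
transitivity (\int[lebesgue_measure]_x ((expR (l ^+ 2 * s ^+ 2 / 2))%:E *
    (normal_pdf (m + l * s ^+ 2) s x)%:E))%E; last first.
  rewrite ge0_integralZl//=.
  - by rewrite integral_normal_pdf mule1.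
  - by apply/measurable_EFinP; exact: measurable_normal_pdf.
  - by move=> x _; rewrite lee_fin normal_pdf_ge0.
apply: eq_integral => x _; rewrite -!EFinM; congr EFin.
rewrite !normal_pdfE// mulrCA [RHS]mulrCA; congr (_ * _).
rewrite /normal_fun -!expRD; congr expR.
by field.
Qed.

End NormalMGF.

Section GaussianTail.
Context d (T : measurableType d) (R : realType) (P : probability T R).
Implicit Types Z : T -> R.

(** What tilting by [x + 2] yields in [gaussian_lower_tail]. What counts is that it
is positive and the same for all Z. *)
Definition tail_bound (x : R) : R :=
  expR ((x + 2) ^+ 2 / 2) * (1 - 2 * expR (- 2)) / expR ((x + 2) * (x + 4)).

Lemma tail_bound_gt0 x : 0 < tail_bound x.
Proof.
rewrite /tail_bound divr_gt0 ?expR_gt0// mulr_gt0 ?expR_gt0// subr_gt0 expRN.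
rewrite ltr_pdivrMr ?expR_gt0// mul1r (lt_le_trans _ (expR_ge1Dx 2))//.
by lra.
Qed.

Lemma measurable_expRM l Z : measurable_fun setT Z ->
  measurable_fun setT (fun w => (expR (l * Z w))%:E).
Proof.
move=> mZ; apply/measurable_EFinP; apply: measurableT_comp => //.
exact: measurable_funM.
Qed.

(** Under the law of Z tilted by [l = x + 2], Z is within 2 of [l] with
probability at least [1 - 2 * expR (- 2)]; this window lies above [x], and the
tilting weight is at most [expR (l * (l + 2))] there. Since exponential moments
are the only input, the lemma applies to sums of replications without computing
their law. *)
Lemma gaussian_lower_tail Z (x : R) : measurable_fun setT Z -> 0 <= x ->
  (forall l, \int[P]_w (expR (l * Z w)%R)%:E = (expR (l ^+ 2 / 2))%:E)%E ->
  ((tail_bound x)%:E <= P [set w | (x <= Z w)%R])%E.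
Proof.
move=> mZ x0 mgf; set E := [set w | _].
have mE : measurable E.
  rewrite (_ : E = Z @^-1` `[x, +oo[); last first.
    by apply/seteqP; split => w; rewrite /E/= in_itv/= andbT.
  by rewrite -[_ @^-1` _]setTI; exact: mZ.
pose l := x + 2.
pose c1 := expR (l * (l + 2)).
pose c2 := expR (- 2 * (l + 2)).
pose c3 := expR (2 * (l - 2)).
(* The first term dominates for Z within 2 of l, the two others for Z beyond
   that window, on the right and on the left. *)
have ptw w : expR (l * Z w) <= c1 * \1_E w
     + (c2 * expR ((l + 2) * Z w) + c3 * expR ((l - 2) * Z w)).
  have p2 : 0 <= c2 * expR ((l + 2) * Z w) by rewrite mulr_ge0 ?expR_ge0.
  have p3 : 0 <= c3 * expR ((l - 2) * Z w) by rewrite mulr_ge0 ?expR_ge0.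
  have p1 : 0 <= c1 * \1_E w by rewrite mulr_ge0 ?expR_ge0.
  have [h|h] := leP (l + 2) (Z w).
    rewrite (@le_trans _ _ (c2 * expR ((l + 2) * Z w)))//; last by lra.
    by rewrite /c2 -expRD ler_expR; lra.
  have [h'|h'] := leP (Z w) (l - 2).
    rewrite (@le_trans _ _ (c3 * expR ((l - 2) * Z w)))//; last by lra.
    by rewrite /c3 -expRD ler_expR; lra.
  rewrite (@le_trans _ _ (c1 * \1_E w))//; last by lra.
  rewrite indicE mem_set ?mulr1; last by rewrite /E/=; rewrite /l in h'; lra.
  by rewrite ler_expR ler_wpM2l//; [rewrite /l; lra|exact: ltW].
have : (\int[P]_w (expR (l * Z w)%R)%:E <= c1%:E * (\int[P]_w (\1_E w)%:E) +
    (c2%:E * (\int[P]_w (expR ((l + 2) * Z w)%R)%:E) +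
     c3%:E * (\int[P]_w (expR ((l - 2) * Z w)%R)%:E)))%E.
  have m2 := measurable_expRM (l + 2) mZ; have m3 := measurable_expRM (l - 2) mZ.
  have m1 : measurable_fun setT (fun w => (\1_E w : R)%:E).
    by apply/measurable_EFinP.
  rewrite -!ge0_integralZl//=; try by move=> ? _; rewrite lee_fin expR_ge0.
  have n1 w : (0 <= c1%:E * (\1_E w)%:E :> \bar R)%E.
    by rewrite -EFinM lee_fin mulr_ge0 ?expR_ge0.
  have n2 w : (0 <= c2%:E * (expR ((l + 2) * Z w)%R)%:E)%E.
    by rewrite -EFinM lee_fin mulr_ge0 ?expR_ge0.
  have n3 w : (0 <= c3%:E * (expR ((l - 2) * Z w)%R)%:E)%E.
    by rewrite -EFinM lee_fin mulr_ge0 ?expR_ge0.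
  have k1 : measurable_fun setT (fun w => c1%:E * (\1_E w)%:E)%E.
    exact: emeasurable_funM.
  have k2 : measurable_fun setT (fun w => c2%:E * (expR ((l + 2) * Z w)%R)%:E)%E.
    exact: emeasurable_funM.
  have k3 : measurable_fun setT (fun w => c3%:E * (expR ((l - 2) * Z w)%R)%:E)%E.
    exact: emeasurable_funM.
  have k23 := emeasurable_funD k2 k3.
  have n23 w := adde_ge0 (n2 w) (n3 w).
  rewrite -!ge0_integralD//=.
  apply: ge0_le_integral => //=.
  - exact: measurable_expRM.
  - exact: emeasurable_funD.
  - by move=> w _; rewrite -!EFinM -!EFinD lee_fin.
  1-3: by rewrite lee_fin expR_ge0.
rewrite (mgf l) (mgf (l + 2)) (mgf (l - 2)).
rewrite (_ : \int[P]_w (\1_E w)%:E = P E)%E; last by rewrite integral_indic// setIT.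
have : P E = (fine (P E))%:E by rewrite fineK// fin_num_measure.
move: (fine (P E)) => p ->; rewrite -!EFinM -!EFinD !lee_fin.
have -> : c2 * expR ((l + 2) ^+ 2 / 2) = expR (l ^+ 2 / 2) * expR (- 2).
  by rewrite /c2 -!expRD; congr expR; field.
have -> : c3 * expR ((l - 2) ^+ 2 / 2) = expR (l ^+ 2 / 2) * expR (- 2).
  by rewrite /c3 -!expRD; congr expR; field.
move=> H; rewrite /tail_bound ler_pdivrMr ?expR_gt0//.
rewrite (_ : (x + 2) * (x + 4) = l * (l + 2)); last by rewrite /l; ring.
by rewrite -/l -/c1; lra.
Qed.

End GaussianTail.

(** * Independence of sigma-algebras *)

Lemma sigma_algebra_setT (T : Type) (G : set (set T)) :
  sigma_algebra setT G -> G setT.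
Proof. by move=> [G0 GC _]; have := GC _ G0; rewrite setTD setC0. Qed.

Lemma sigma_algebra_setI (T : pointedType) (G : set (set T)) :
  sigma_algebra setT G -> setI_closed G.
Proof.
move=> [G0 GC GU] A B GA GB.
pose GTy : measurableType _ := g_sigma_algebraType G.
have sG : <<s G >> = G by apply: smallest_id; split.
rewrite -sG; apply: (@measurableI _ GTy); exact: sub_sigma_algebra.
Qed.

Section SigmaOf.
Context d (T : measurableType d) (R : realType) (P : probability T R).
Context (I : eqType) (X : I -> {RV P >-> R}).
Implicit Types (G : set (set T)) (J : set I).

Definition observed G J : set (set T) :=
  G `|` [set E | exists j (B : set R), [/\ J j, measurable B & E = X j @^-1` B]].

Definition sigma_of G J : set (set T) := <<s observed G J >>.

(** T with the events of [sigma_of G J] as its measurable sets: a function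
measurable for this structure depends only on the exogenous information and on
the replications indexed by J. *)
Definition sigmaType G J := g_sigma_algebraType (observed G J).

(** Independence is given for cylinders cut by an exogenous event. These form a
pi-system, and they generate the same sigma-algebra as [observed]. *)
Definition observed_pi G J : set (set T) :=
  [set E | exists g L (B : I -> set R), [/\ G g, uniq L,
     forall j, j \in L -> J j, forall j, measurable (B j) &
     E = g `&` cylinder X L B]].

Lemma measurable_RV j (B : set R) : measurable B -> measurable (X j @^-1` B).
Proof. by move=> mB; exact: measurable_funPTI. Qed.

Lemma cylinder_cons j L (B : I -> set R) :
  cylinder X (j :: L) B = (X j @^-1` B j) `&` cylinder X L B.
Proof.
apply/seteqP; split => w.
  by move=> H; split=> [|i iL]; apply: H; rewrite inE ?eqxx// iL orbT.
by move=> [Hj HL] i; rewrite inE => /orP[/eqP->//|/HL].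
Qed.

Lemma measurable_cylinder L (B : I -> set R) :
  (forall j, measurable (B j)) -> measurable (cylinder X L B).
Proof.
move=> mB; elim: L => [|j L IH].
  by rewrite (_ : cylinder X [::] B = setT)//; apply/seteqP; split.
by rewrite cylinder_cons; apply: measurableI => //; exact: measurable_RV.
Qed.

Lemma observed_pi_measurable G J : G `<=` measurable ->
  observed_pi G J `<=` measurable.
Proof.
move=> GT _ [g [L [B [/GT mg _ _ mB ->]]]].
by apply: measurableI => //; exact: measurable_cylinder.
Qed.

Lemma setI_closed_observed_pi G J : setI_closed G -> setI_closed (observed_pi G J).
Proof.
move=> GI _ _ [g [L [B [Gg _ LJ mB ->]]]] [g' [L' [B' [Gg' _ LJ' mB' ->]]]].
exists (g `&` g'), (undup (L ++ L')),
  (fun j => (if j \in L then B j else setT) `&` (if j \in L' then B' j else setT)).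
split; [exact: GI|exact: undup_uniq| | |].
- by move=> j; rewrite mem_undup mem_cat => /orP[/LJ|/LJ'].
- by move=> j; apply: measurableI; case: ifP.
- apply/seteqP; split => w.
    move=> [[gw Hw] [gw' Hw']]; split => // j _.
    by split; case: ifPn => //; [move=> /Hw|move=> /Hw'].
  move=> [[gw gw'] H]; split; split => // j jL.
    by have := H j; rewrite mem_undup mem_cat jL => /(_ isT)[].
  by have := H j; rewrite mem_undup mem_cat jL orbT => /(_ isT)[].
Qed.

Lemma observed_sub_pi G J : G setT -> observed G J `<=` observed_pi G J.
Proof.
move=> GT E [GE|[j [B [Jj mB ->]]]].
  exists E, [::], (fun=> setT); split => //.
  by apply/seteqP; split => w // [].
exists setT, [:: j], (fun=> B); split => //.
  by move=> i; rewrite inE => /eqP->.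
rewrite cylinder_cons setTI; apply/seteqP; split => w; last by case.
by move=> H; split.
Qed.

Lemma sigma_of_measurable G J : G `<=` measurable ->
  sigma_of G J `<=` measurable.
Proof.
move=> GM; apply: smallest_sub; first exact: sigma_algebra_measurable.
by move=> E [/GM//|[j [B [_ mB ->]]]]; exact: measurable_RV.
Qed.

Lemma sigma_ofS G G' J J' : G `<=` G' -> J `<=` J' ->
  sigma_of G J `<=` sigma_of G' J'.
Proof.
move=> GG JJ; apply: sub_sigma_algebra2.
move=> E [GE|[j [B [Jj mB EB]]]]; first by left; exact: GG.
by right; exists j, B; split => //; exact: JJ.
Qed.

Lemma sigma_of_X G J j (B : set R) : J j -> measurable B ->
  sigma_of G J (X j @^-1` B).
Proof. by move=> Jj mB; apply: sub_sigma_algebra; right; exists j, B. Qed.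

Lemma measurable_sigma_X G J j : J j ->
  measurable_fun (setT : set (sigmaType G J)) (X j).
Proof. by move=> Jj _ B mB; rewrite setTI; exact: sigma_of_X. Qed.

Lemma sigma_of_fun G J (f : T -> R) (B : set R) :
  measurable_fun (setT : set (sigmaType G J)) f -> measurable B ->
  sigma_of G J (f @^-1` B).
Proof. by move=> mf mB; rewrite -[_ @^-1` _]setTI; exact: mf. Qed.

Lemma sigma_of_measurable_fun G J (f : T -> R) : G `<=` measurable ->
  measurable_fun (setT : set (sigmaType G J)) f -> measurable_fun setT f.
Proof.
move=> GM mf _ B mB; apply: (sigma_of_measurable GM (J := J)).
by rewrite setTI; exact: sigma_of_fun.
Qed.

(** The events independent of F form a lambda-system. *)
Lemma indep_pilambda (C : set (set T)) (F : set T) :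
  C `<=` measurable -> setI_closed C -> measurable F ->
  (forall E, C E -> P (E `&` F) = P E * P F)%E ->
  forall E, <<s C >> E -> P (E `&` F) = (P E * P F)%E.
Proof.
move=> CM CI mF H E CE.
have fP A : measurable A -> P A = (fine (P A))%:E.
  by move=> mA; rewrite fineK// fin_num_measure.
suff : [set E | measurable E /\ P (E `&` F) = (P E * P F)%E] E by case.
move: E CE; apply: lambda_system_subset => //; last first.
  by move=> E CE; split; [exact: CM|exact: H].
apply/dynkin_lambda_system; split.
- by split => //; rewrite setTI probability_setT mul1e.
- move=> A [mA HA]; split; first exact: measurableC.
  have mAF := measurableI _ _ mA mF.
  have E1 : P (~` A `&` F) = (P F - P (A `&` F))%E.
    rewrite setIC -setDE [A `&` F]setIC; apply: measureD => //.
    by rewrite (le_lt_trans (probability_le1 P mF))// ltry.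
  have E2 : P (~` A) = (1 - P A)%E by exact: probability_setC.
  rewrite E1 E2 HA (fP A)// (fP F)// -!EFinM -!EFinB. congr EFin.
  by ring.
- move=> A tA HA; have mA n : measurable (A n) by have [] := HA n.
  split; first exact: bigcup_measurable.
  have E1 : P (\bigcup_k A k `&` F) = (\sum_(0 <= n <oo) P (A n `&` F))%E.
    rewrite setI_bigcupl; apply: measure_semi_bigcup => //.
    - by move=> n; exact: measurableI.
    - exact: trivIset_setIr.
    - by apply: bigcup_measurable => n _; exact: measurableI.
  have E2 : P (\bigcup_k A k) = (\sum_(0 <= n <oo) P (A n))%E.
    by apply: measure_semi_bigcup => //; exact: bigcup_measurable.
  rewrite E1 E2 (eq_eseriesr (fun n _ => (HA n).2)) (fP F)// muleC.
  rewrite -nneseriesZl//.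
  by apply: eq_eseriesr => n _; rewrite muleC.
Qed.

Hypothesis Xind : mutually_independent X.

Lemma cylinder_cat_indep G J K L L' (B B' : I -> set R) g : G g ->
  independent_of X G -> [disjoint J & K] -> uniq L -> uniq L' ->
  (forall j, j \in L -> J j) -> (forall j, j \in L' -> K j) ->
  (forall j, measurable (B j)) -> (forall j, measurable (B' j)) ->
  P (g `&` cylinder X L B `&` cylinder X L' B') =
  (P (g `&` cylinder X L B) * P (cylinder X L' B'))%E.
Proof.
move=> Gg XG dJK uL uL' LJ LK mB mB'.
have LL' j : j \in L' -> (j \in L) = false.
  move=> jL'; apply/negP => jL.
  by move/eqP: dJK => /seteqP[+ _] => /(_ j); apply; split; [exact: LJ|exact: LK].
pose B2 j := if j \in L then B j else B' j.
have mB2 j : measurable (B2 j) by rewrite /B2; case: ifP.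
have u2 : uniq (L ++ L').
  by rewrite cat_uniq uL uL' andbT; apply/hasPn => j /LL' /= ->.
have e1 : cylinder X L B `&` cylinder X L' B' = cylinder X (L ++ L') B2.
  apply/seteqP; split => w.
    move=> [H H'] j; rewrite mem_cat /B2; case: ifP => [jL _|_ /= jL]; first exact: H.
    exact: H'.
  move=> H; split => j jL; have := H j; rewrite mem_cat jL /B2 ?jL ?orbT => /(_ isT)//.
  by rewrite (LL' _ jL).
rewrite -setIA e1 (XG _ _ _ Gg mB2) (XG _ _ _ Gg mB) -muleA; congr (_ * _)%E.
rewrite (Xind u2 mB2) (Xind uL mB) (Xind uL' mB') big_cat/=; congr (_ * _)%E.
  by apply: eq_big_seq => j jL; rewrite /B2 jL.
by apply: eq_big_seq => j jL; rewrite /B2 (LL' _ jL).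
Qed.

(** Two rounds of the pi-lambda argument, one for each event. The exogenous events
enter on one side only, since they are not independent of themselves. *)
Lemma sigma_of_indep G J K E F :
  G `<=` measurable -> sigma_algebra setT G -> independent_of X G ->
  [disjoint J & K] -> sigma_of G J E -> sigma_of set0 K F ->
  P (E `&` F) = (P E * P F)%E.
Proof.
move=> GM hG XG dJK sE sF.
have GT := sigma_algebra_setT hG; have GI := sigma_algebra_setI hG.
pose G1 : set (set T) := [set setT].
have G1T : G1 setT by [].
have G1I : setI_closed G1 by move=> A B -> ->; rewrite setTI.
have G1M : G1 `<=` measurable by move=> A ->.
have sF' : <<s observed_pi G1 K >> F.
  apply: (sub_sigma_algebra2 (observed_sub_pi (J := K) G1T)).
  by move: sF; apply: sigma_ofS.
have sE' : <<s observed_pi G J >> E.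
  by move: sE; apply: sub_sigma_algebra2; exact: observed_sub_pi.
have mE : measurable E by exact: sigma_of_measurable sE.
rewrite setIC muleC; move: sF'; apply: indep_pilambda => //.
- exact: observed_pi_measurable.
- exact: setI_closed_observed_pi.
move=> _ [_ [L' [B' [-> uL' LK mB' ->]]]].
have mc := measurable_cylinder L' mB'.
rewrite setTI setIC [RHS]muleC; move: sE'; apply: indep_pilambda => //.
- exact: observed_pi_measurable.
- exact: setI_closed_observed_pi.
move=> _ [g [L [B [Gg uL LJ mB ->]]]].
exact: (cylinder_cat_indep Gg XG dJK uL uL' LJ LK mB mB').
Qed.

End SigmaOf.

(** * Independent pairs, increasing unions and null sets *)

Section IndependentPair.
Context d (T : measurableType d) (R : realType) (P : probability T R).
Variables U V : T -> R.
Hypotheses (mU : measurable_fun setT U) (mV : measurable_fun setT V).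
Hypothesis UV : forall A B : set R, measurable A -> measurable B ->
  P (U @^-1` A `&` V @^-1` B) = (P (U @^-1` A) * P (V @^-1` B))%E.

Let Um : {RV P >-> R} := HB.pack U (isMeasurableFun.Build _ _ _ _ U mU).
Let Vm : {RV P >-> R} := HB.pack V (isMeasurableFun.Build _ _ _ _ V mV).
Let mUV : measurable_fun setT (fun w => (U w, V w)).
Proof. exact: measurable_fun_pair. Qed.
Let UVm : {RV P >-> (R * R)%type} :=
  HB.pack (fun w => (U w, V w)) (isMeasurableFun.Build _ _ _ _ _ mUV).

Let jointE A : measurable A ->
  distribution P UVm A = (distribution P Um \x distribution P Vm)%E A.
Proof.
move=> mA; apply/esym/product_measure_unique => //.
Qed.

Lemma indep_expectationM : (forall w, 0 <= U w) -> (forall w, 0 <= V w) ->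
  (\int[P]_w (U w * V w)%:E = (\int[P]_w (U w)%:E) * (\int[P]_w (V w)%:E))%E.
Proof.
move=> U0 V0.
pose f (z : R * R) : \bar R := (`|z.1| * `|z.2|)%:E.
have mf : measurable_fun setT f.
  apply/measurable_EFinP; apply: measurable_funM.
    by apply: measurableT_comp => //; exact: measurable_fst.
  by apply: measurableT_comp => //; exact: measurable_snd.
have f0 z : (0 <= f z)%E by rewrite lee_fin mulr_ge0.
have mabs : measurable_fun setT (fun y : R => `|y|%:E : \bar R).
  by apply/measurable_EFinP.
transitivity (\int[distribution P UVm]_z f z)%E.
  rewrite ge0_integral_distribution//.
  by apply: eq_integral => w _; rewrite /f/= !ger0_norm.
rewrite (eq_measure_integral (distribution P Um \x distribution P Vm)%E); last first.
  by move=> A mA _; exact: jointE.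
rewrite fubini_tonelli1// /fubini_F/= /f/=.
under eq_integral do under eq_integral do rewrite EFinM.
transitivity (\int[distribution P Um]_x
    (`|x|%:E * \int[distribution P Vm]_y `|y|%:E))%E.
  by apply: eq_integral => x _; rewrite ge0_integralZl.
rewrite ge0_integralZr//; last exact: integral_ge0.
by congr (_ * _)%E; rewrite ge0_integral_distribution//;
  apply: eq_integral => w _ /=; rewrite ger0_norm.
Qed.

(** The slices of the diagonal are single points, which the law of V does not
charge. *)
Lemma indep_atomless_neq : (forall x, P (V @^-1` [set x]) = 0)%E ->
  P [set w | U w = V w] = 0%E.
Proof.
move=> V0; pose D : set (R * R) := [set z | z.1 = z.2].
have mD : measurable D.
  have -> : D = (fun z => z.1 - z.2) @^-1` [set 0].
    apply/seteqP; split => z; rewrite /D/=; last by move/subr0_eq.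
    by move=> ->; rewrite subrr.
  rewrite -[_ @^-1` _]setTI; apply: measurable_funB => //.
rewrite [LHS](_ : _ = distribution P UVm D)// jointE//.
rewrite /product_measure1/=; apply: integral0_eq => x _.
rewrite (_ : xsection D x = [set x]); first exact: V0.
by apply/seteqP; split => y; rewrite /xsection/= inE /D/=.
Qed.

End IndependentPair.

Section IncreasingUnion.
Context d (T : measurableType d) (R : realType) (P : {measure set T -> \bar R}).

Lemma measure_nondecreasing_bigcup_le (C : (set T)^nat) (c : \bar R) :
  (forall n, measurable (C n)) -> (forall n, C n `<=` C n.+1) ->
  (forall n, (P (C n) <= c)%E) -> (P (\bigcup_n C n) <= c)%E.
Proof.
move=> mC CS PC.
have ndC : nondecreasing_seq C.
  by apply/nondecreasing_seqP => n; apply/subsetPset; exact: CS.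
have cv := nondecreasing_cvg_mu (mu := P) mC (bigcup_measurable (fun n _ => mC n)) ndC.
have cC : cvgn (P \o C) by apply/cvg_ex; eexists; exact: cv.
rewrite -(cvg_lim _ cv)//; apply: lime_le => //.
by apply: nearW => n; exact: PC.
Qed.

End IncreasingUnion.

Section Negligible.
Context d (T : measurableType d) (R : realType) (P : {measure set T -> \bar R}).

Lemma negligible_small (N : set T) :
  (forall e : R, 0 < e -> exists F, [/\ measurable F, N `<=` F & (P F <= e%:E)%E]) ->
  P.-negligible N.
Proof.
move=> H.
have {}H j : exists F, [/\ measurable F, N `<=` F & (P F <= (j.+1%:R^-1)%:E)%E].
  exact: H.
have [F HF] := choice H.
exists (\bigcap_j F j); split; last 2 first.
- apply/eqP; rewrite eq_le measure_ge0 andbT; apply/lee_addgt0Pr => e e0.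
  rewrite add0e; have [j je] : exists j : nat, j.+1%:R^-1 <= e.
    exists (Num.truncn e^-1); rewrite -[leRHS]invrK lef_pV2 ?posrE ?invr_gt0//.
    by apply: ltW; exact: truncnS_gt.
  have [mF _ PF] := HF j.
  apply: (@le_trans _ _ (P (F j))); last by rewrite (le_trans PF)// lee_fin.
  apply: le_measure; rewrite ?inE//; last by move=> w; apply.
  by apply: bigcapT_measurable => i; have [] := HF i.
- by move=> w Nw j _; have [_ + _] := HF j; apply.
- by apply: bigcapT_measurable => i; have [] := HF i.
Qed.

End Negligible.

(** * Sums of Gaussian replications *)

Section GaussianModel.
Context d (T : measurableType d) (R : realType) (P : probability T R).
Context (E : eqType) (X : E * nat -> {RV P >-> R}) (mu sigma : E -> R).
Context (G : set (set T)).
Hypotheses (hG : sigma_algebra setT G) (hGm : G `<=` measurable).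
Hypotheses (hXG : independent_of X G) (hXindep : mutually_independent X).
Hypothesis sigma_gt0 : forall p, 0 < sigma p.
Hypothesis hXlaw : forall p n (B : set R), measurable B ->
  distribution P (X (p, n)) B = normal_prob (mu p) (sigma p) B.

Local Notation sigmaT J := (sigmaType X G J).
Local Notation adapted J f := (measurable_fun (setT : set (sigmaT J)) f).

Definition cent (p : E) (n : nat) (w : T) : R := X (p, n) w - mu p.

Definition csum (p : E) (a b : nat) (w : T) : R := \sum_(a <= i < b) cent p i w.

Definition past (p : E) (n : nat) : set (E * nat) :=
  [set j | j.1 = p /\ (j.2 < n)%N].

Lemma cent_mgf p n l :
  (\int[P]_w (expR (l * cent p n w)%R)%:E =
   (expR (l ^+ 2 * sigma p ^+ 2 / 2)%R)%:E)%E.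
Proof.
have ml : measurable_fun [set: R] (fun x : R => (expR (l * (x - mu p)))%:E).
  apply/measurable_EFinP; apply: measurableT_comp => //.
  by apply: measurable_funM => //; exact: measurable_funB.
have e0 (x : R) : (0 <= (expR (l * (x - mu p)))%:E)%E by rewrite lee_fin expR_ge0.
rewrite -(normal_mgf (mu p)) ?gt_eqF//.
transitivity (\int[distribution P (X (p, n))]_x (expR (l * (x - mu p)))%:E)%E.
  by rewrite ge0_integral_distribution.
(* The canonical measurable structure on the reals is a copy of the one that
   carries the normal law. *)
pose idR (x : measurableTypeR R) : R := x.
have midR : measurable_fun setT idR by move=> _ B mB; rewrite setTI.
rewrite (eq_measure_integral (pushforward (normal_prob (mu p) (sigma p)) idR)); last first.
  by move=> B mB _; exact: hXlaw.
by rewrite ge0_integral_pushforward.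
Qed.

Lemma X_atomless p n x : P (X (p, n) @^-1` [set x]) = 0%E.
Proof.
rewrite [LHS](hXlaw p n (measurable_set1 x)).
have /null_content_dominatesP := normal_prob_dominates (mu p) (sigma p).
by apply => //; exact: lebesgue_measure_set1.
Qed.

Lemma adapted_indep J K (U V : T -> R) : [disjoint J & K] ->
  adapted J U -> measurable_fun (setT : set (sigmaType X set0 K)) V ->
  forall A B : set R, measurable A -> measurable B ->
  P (U @^-1` A `&` V @^-1` B) = (P (U @^-1` A) * P (V @^-1` B))%E.
Proof.
move=> JK mU mV A B mA mB.
apply: (sigma_of_indep hXindep hGm hG hXG JK); exact: sigma_of_fun.
Qed.

Lemma adapted_measurable J (U : T -> R) : adapted J U -> measurable_fun setT U.
Proof. exact: sigma_of_measurable_fun. Qed.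

Lemma adapted_cent G' J p n : J (p, n) ->
  measurable_fun (setT : set (sigmaType X G' J)) (cent p n).
Proof. by move=> Jj; apply: measurable_funB => //; exact: measurable_sigma_X. Qed.

(** U does not depend on replication n of p, so that the expectation factors. This
is the step by which exponentials of sums are martingales. *)
Lemma mgf_step J p n l (U : T -> R) : ~ J (p, n) -> adapted J U ->
  (forall w, 0 <= U w) ->
  (\int[P]_w (U w * expR (l * cent p n w))%:E =
   (\int[P]_w (U w)%:E) * (expR (l ^+ 2 * sigma p ^+ 2 / 2)%R)%:E)%E.
Proof.
move=> nJ aU U0; rewrite -(cent_mgf p n).
have aV : measurable_fun (setT : set (sigmaType X set0 [set (p, n)]))
    (fun w => expR (l * cent p n w)).
  apply: measurableT_comp => //; apply: measurable_funM => //.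
  exact: adapted_cent.
apply: indep_expectationM => //.
- exact: adapted_measurable aU.
- by apply: sigma_of_measurable_fun aV => A.
- apply: (adapted_indep _ aU aV); apply/eqP; apply/seteqP; split => // j [Jj] /=.
  by move=> jE; apply: nJ; rewrite -jE.
Qed.

Lemma csumS p a n w : csum p a (a + n.+1) w = csum p a (a + n) w + cent p (a + n) w.
Proof. by rewrite /csum addnS big_nat_recr//= leq_addr. Qed.

Lemma csum0 p a w : csum p a (a + 0) w = 0.
Proof. by rewrite /csum addn0 big_geq. Qed.

Lemma adapted_csum G' J p a n : (forall i, (a <= i < a + n)%N -> J (p, i)) ->
  measurable_fun (setT : set (sigmaType X G' J)) (csum p a (a + n)).
Proof.
elim: n => [|n IH] H.
  rewrite (_ : csum _ _ _ = cst 0)//; apply/funext => w; exact: csum0.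
rewrite (_ : csum _ _ _ = (fun w => csum p a (a + n) w + cent p (a + n) w)).
  apply: measurable_funD; first by apply: IH => i /andP[ai lt]; apply: H; lia.
  by apply: adapted_cent; apply: H; lia.
by apply/funext => w; exact: csumS.
Qed.

Lemma csum_mgf p a n l :
  (\int[P]_w (expR (l * csum p a (a + n) w)%R)%:E =
   (expR (l ^+ 2 * (sigma p ^+ 2 * n%:R) / 2)%R)%:E)%E.
Proof.
elim: n => [|n IH].
  under eq_integral do rewrite csum0 mulr0 expR0.
  rewrite integral_cst// [X in (_ * X)%E](_ : _ = 1%E); last exact: probability_setT.
  by rewrite mul1e !mulr0 mul0r expR0.
under eq_integral do rewrite csumS mulrDr expRD.
rewrite (@mgf_step [set j | j.1 = p /\ (j.2 < a + n)%N]).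
- rewrite IH -EFinM -expRD; congr (expR _)%:E.
  by rewrite -natr1; field.
- by case=> _ /=; rewrite ltnn.
- apply: measurableT_comp => //; apply: measurable_funM => //.
  by apply: adapted_csum => i /andP[_ ?].
- by move=> w; exact: expR_ge0.
Qed.

Section Ville.
Variables (p : E) (l a : R).

Let expo n w := l * csum p 0 n w - n%:R * (l ^+ 2 * sigma p ^+ 2 / 2).

(** The exponential martingale [expR (expo n w)], frozen from the first time that
it reaches [expR a]. *)
Fixpoint stopped_exp n w : R :=
  if n is m.+1 then
    if expR a <= stopped_exp m w then stopped_exp m w
    else stopped_exp m w * (expR (l * cent p m w) * expR (- (l ^+ 2 * sigma p ^+ 2 / 2)))
  else 1.

Let Q := stopped_exp.

Let Q_ge0 n w : 0 <= Q n w.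
Proof.
elim: n => [|n IH] /=; first exact: ler01.
by case: ifP => // _; rewrite !mulr_ge0 ?expR_ge0.
Qed.

Let Q_adapted n : adapted (past p n) (Q n).
Proof.
elim: n => [|n IH] /=; first exact: measurable_cst.
have IH' : adapted (past p n.+1) (Q n).
  move=> _ B mB; rewrite setTI.
  apply: (@sigma_ofS _ _ _ _ _ _ G G (past p n)) => //.
    by move=> j [jp jn]; split => //; exact: ltnW.
  exact: sigma_of_fun.
apply: measurable_fun_ifT => //.
  by apply: measurable_fun_ler => //; exact: measurable_cst.
apply: measurable_funM => //; apply: measurable_funM => //.
apply: measurableT_comp => //; apply: measurable_funM => //.
by apply: adapted_cent; split => /=.
Qed.

Let Q_expectation n : (\int[P]_w (Q n w)%:E = 1)%E.
Proof.
elim: n => [|n IH].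
  by rewrite /= integral_cst// mul1e; exact: probability_setT.
pose U w := if expR a <= Q n w then Q n w else 0.
pose V w := if expR a <= Q n w then 0 else Q n w.
have mQ := @Q_adapted n.
have mc : measurable_fun (setT : set (sigmaT (past p n))) (fun w => expR a <= Q n w).
  by apply: measurable_fun_ler => //; exact: measurable_cst.
have aU : adapted (past p n) U by apply: measurable_fun_ifT.
have aV : adapted (past p n) V by apply: measurable_fun_ifT.
have U0 w : 0 <= U w by rewrite /U; case: ifP.
have V0 w : 0 <= V w by rewrite /V; case: ifP.
have mU := adapted_measurable aU; have mV := adapted_measurable aV.
have mE : measurable_fun setT (fun w => V w * expR (l * cent p n w)).
  apply: measurable_funM => //; apply: measurableT_comp => //.
  by apply: measurable_funM => //; apply: measurable_funB.
transitivity (\int[P]_w ((U w)%:E +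
    (expR (- (l ^+ 2 * sigma p ^+ 2 / 2)))%:E * (V w * expR (l * cent p n w))%:E))%E.
  apply: eq_integral => w _; rewrite -EFinM -EFinD; congr EFin.
  rewrite /= /U /V -/(Q n w); case: ifP => _; first by rewrite mul0r mulr0 addr0.
  by rewrite add0r; ring.
have E2 : (\int[P]_w ((U w)%:E + (V w)%:E) = 1)%E.
  rewrite -IH; apply: eq_integral => w _; rewrite -EFinD; congr EFin.
  by rewrite /U /V; case: ifP => _; rewrite ?addr0 ?add0r.
have eM : measurable_fun setT (fun w => (V w * expR (l * cent p n w))%:E).
  exact/measurable_EFinP.
have eU : measurable_fun setT (fun w => (U w)%:E) by exact/measurable_EFinP.
have eV : measurable_fun setT (fun w => (V w)%:E) by exact/measurable_EFinP.
have M0 w : (0 <= (V w * expR (l * cent p n w))%:E)%E.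
  by rewrite lee_fin mulr_ge0 ?expR_ge0.
have c0 : (0 <= (expR (- (l ^+ 2 * sigma p ^+ 2 / 2)))%:E)%E.
  by rewrite lee_fin expR_ge0.
rewrite ge0_integralD//.
- rewrite ge0_integralZl// (@mgf_step (past p n))//.
    rewrite muleCA -EFinM -expRD addNr expR0 mule1 -ge0_integralD//.
    - by move=> w _; rewrite lee_fin.
    - by move=> w _; rewrite lee_fin.
  by case=> _ /=; rewrite ltnn.
- by move=> w _; rewrite lee_fin.
- by move=> w _; rewrite mule_ge0.
- exact: emeasurable_funM.
Qed.

Let Q_cross n w : (exists2 i, (i <= n)%N & a <= expo i w) -> expR a <= Q n w.
Proof.
elim: n => [|n IH].
  move=> [i]; rewrite leqn0 => /eqP->.
  by rewrite /expo /csum big_geq// mulr0 mul0r subr0 -ler_expR expR0.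
move=> [i iN ai]; rewrite /=; case: ifPn => // nQ.
have nex : ~ (exists2 i, (i <= n)%N & a <= expo i w).
  by move=> /IH; exact/negP.
(* Nothing has been frozen before the first crossing. *)
have -> : Q n w = expR (expo n w).
  elim: n {iN IH} nQ nex => [|n IH] /= nQ nex.
    by rewrite /expo /csum big_geq// mulr0 mul0r subr0 expR0.
  case: ifPn nQ => [-> //|nQ' _].
  rewrite IH// -?expRD; last by move=> [j jn aj]; apply: nex; exists j => //; lia.
  congr expR; rewrite /expo -[n.+1]add0n csumS add0n -natr1; ring.
have iE : i = n.+1.
  apply/eqP; rewrite eqn_leq iN ltnNge; apply/negP => ltn.
  by apply: nex; exists i.
rewrite -!expRD ler_expR (le_trans ai)// iE /expo -[n.+1]add0n csumS add0n -natr1.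
by rewrite le_eqVlt; apply/orP; left; apply/eqP; ring.
Qed.

Lemma ville_measurable : measurable [set w | exists n, a <= expo n w].
Proof.
rewrite (_ : mkset _ = \bigcup_n [set w | a <= expo n w]); last first.
  by apply/seteqP; split => w [n]; exists n.
apply: bigcup_measurable => n _.
rewrite (_ : mkset _ = (expo n) @^-1` `[a, +oo[); last first.
  by apply/seteqP; split => w; rewrite /= in_itv/= andbT.
rewrite -[_ @^-1` _]setTI.
suff : measurable_fun setT (expo n) by exact.
apply: measurable_funB => //; apply: measurable_funM => //.
apply: (@adapted_measurable (past p n)).
by rewrite -[n]add0n; apply: adapted_csum.
Qed.

(** Ville's inequality: the frozen martingale has expectation 1 at every time, and
a crossing keeps it above [expR a] for ever. Markov's inequality at time n then
bounds the probability of a crossing by time n, uniformly in n. *)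
Lemma ville : (P [set w | exists n, (a <= expo n w)%R] <= (expR (- a))%:E)%E.
Proof.
pose C n := [set w | expR a <= Q n w].
have mC n : measurable (C n).
  rewrite (_ : C n = (Q n) @^-1` `[expR a, +oo[); last first.
    by apply/seteqP; split => w; rewrite /C/= in_itv/= andbT.
  by rewrite -[_ @^-1` _]setTI; apply: adapted_measurable.
have PC n : (P (C n) <= (expR (- a))%:E)%E.
  have mQ : measurable_fun setT (fun w => (Q n w)%:E).
    by apply/measurable_EFinP; exact: adapted_measurable (@Q_adapted n).
  have H : ((expR a)%:E * P (C n) <= 1)%E.
    rewrite -(Q_expectation n) -(setIT (C n)) -integral_indic//.
    rewrite -ge0_integralZl ?lee_fin ?expR_ge0//.
      apply: ge0_le_integral => //.
      - by apply: emeasurable_funM => //; apply/measurable_EFinP.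
      - move=> w _; rewrite -EFinM lee_fin indicE.
        have [|_] := boolP (w \in C n); last by rewrite mulr0.
        by rewrite inE mulr1.
    by apply/measurable_EFinP.
  have : P (C n) = (fine (P (C n)))%:E by rewrite fineK// fin_num_measure.
  move: (fine _) H => r + PE; rewrite PE -EFinM !lee_fin => H.
  by rewrite expRN -[leRHS]mulr1 ler_pdivlMl ?expR_gt0.
apply: (@le_trans _ _ (P (\bigcup_n C n))).
  apply: le_measure; rewrite ?inE.
  - exact: ville_measurable.
  - by apply: bigcup_measurable => n _.
  - move=> w [n an]; exists n => //; apply: Q_cross; by exists n.
apply: measure_nondecreasing_bigcup_le => // n w.
move=> CQ; have {}CQ : expR a <= stopped_exp n w := CQ.
by rewrite /C/mkset/Q [stopped_exp _.+1 _]/= CQ.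
Qed.

End Ville.

(** A line of the slope that makes the exponential a martingale is crossed with a
probability that decays exponentially in its intercept. *)
Lemma csum_tight p l :
  P.-negligible [set w | ~ exists a : nat, forall n,
     l * csum p 0 n w < a%:R + n%:R * (l ^+ 2 * sigma p ^+ 2 / 2)].
Proof.
apply: negligible_small => e e0.
have ae : expR (- (Num.truncn (- ln e)).+1%:R) <= e.
  by rewrite -[leRHS]lnK ?posrE// ler_expR lerNl ltW// truncnS_gt.
set b := (Num.truncn (- ln e)).+1 in ae.
exists [set w | exists n, b%:R <= l * csum p 0 n w - n%:R * (l ^+ 2 * sigma p ^+ 2 / 2)].
split; first exact: ville_measurable.
- move=> w /= H; apply: contrapT => nH; apply: H; exists b => n.
  rewrite -ltrBlDr ltNge; apply/negP => h; apply: nH; exists n.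
  by rewrite (le_trans h).
- by apply: (le_trans (ville p l b%:R)); rewrite lee_fin.
Qed.

(** For [l = 1 / (j + 1)] and its opposite, [csum_tight] bounds the sum of n terms
by [(j + 1) * a + n * sigma p ^+ 2 / (2 * (j + 1))] for a random [a]. Divide by
n, then let j grow. *)
Lemma slln p : {ae P, forall w, csum p 0 n w / n%:R @[n --> \oo] --> (0 : R)}.
Proof.
have H (j : nat) (s : bool) := csum_tight p ((-1) ^+ s / j.+1%:R).
have : P.-negligible (\bigcup_j ([set w | ~ exists a : nat, forall n,
     ((-1) ^+ true / j.+1%:R) * csum p 0 n w <
       a%:R + n%:R * (((-1) ^+ true / j.+1%:R) ^+ 2 * sigma p ^+ 2 / 2)] `|`
     [set w | ~ exists a : nat, forall n,
     ((-1) ^+ false / j.+1%:R) * csum p 0 n w <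
       a%:R + n%:R * (((-1) ^+ false / j.+1%:R) ^+ 2 * sigma p ^+ 2 / 2)])).
  by apply: negligible_bigcup => j; apply: negligibleU; exact: H.
apply: negligibleS => w /= nc; apply: contrapT => nN; apply: nc.
apply/cvgrPdist_le => e e0.
have [j je] : exists j : nat, sigma p ^+ 2 / j.+1%:R <= e.
  exists (Num.truncn (sigma p ^+ 2 / e)); rewrite ler_pdivrMr// -ler_pdivrMl//.
  by rewrite mulrC ltW// truncnS_gt.
have [a1 Ha1] : exists a : nat, forall n, - (csum p 0 n w / j.+1%:R) <
       a%:R + n%:R * ((j.+1%:R^-1) ^+ 2 * sigma p ^+ 2 / 2).
  apply: contrapT => nH; apply: nN; exists j => //; left => -[a Ha].
  apply: nH; exists a => n; have := Ha n.
  by rewrite expr1 mulN1r sqrrN mulNr [_^-1 * csum _ _ _ _]mulrC.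
have [a2 Ha2] : exists a : nat, forall n, csum p 0 n w / j.+1%:R <
       a%:R + n%:R * ((j.+1%:R^-1) ^+ 2 * sigma p ^+ 2 / 2).
  apply: contrapT => nH; apply: nN; exists j => //; right => -[a Ha].
  apply: nH; exists a => n; have := Ha n.
  by rewrite expr0 mul1r [_^-1 * csum _ _ _ _]mulrC.
pose a := (maxn a1 a2)%:R : R.
have Ha n : `|csum p 0 n w| <= a * j.+1%:R + n%:R * (sigma p ^+ 2 / j.+1%:R / 2).
  have j0 : j.+1%:R != 0 :> R by [].
  have eqj : a * j.+1%:R + n%:R * (sigma p ^+ 2 / j.+1%:R / 2) =
      (a + n%:R * (j.+1%:R^-1 ^+ 2 * sigma p ^+ 2 / 2)) * j.+1%:R by field.
  have a1a : a1%:R <= a by rewrite ler_nat leq_maxl.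
  have a2a : a2%:R <= a by rewrite ler_nat leq_maxr.
  have njE : `|csum p 0 n w| / j.+1%:R = `|csum p 0 n w / j.+1%:R|.
    by rewrite normf_div [`|j.+1%:R|]ger0_norm.
  rewrite eqj -ler_pdivrMr// njE ler_norml.
  have := Ha1 n; have := Ha2 n.
  set u := csum _ _ _ _ / _; set v := n%:R * _; move=> h2 h1.
  by apply/andP; split; lra.
near=> n.
have n0 : 0 < n%:R :> R by rewrite ltr0n; near: n; exists 1%N.
rewrite sub0r normrN normf_div (ger0_norm (ltW n0)) ler_pdivrMr//.
apply: (le_trans (Ha n)).
have h1 : a * j.+1%:R <= n%:R * (e / 2).
  rewrite -ler_pdivrMr ?divr_gt0//.
  near: n; exists (Num.truncn (a * j.+1%:R / (e / 2))).+1 => // n /= nle.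
  apply: (le_trans (ltW (truncnS_gt _))); by rewrite ler_nat.
have h2 : n%:R * (sigma p ^+ 2 / j.+1%:R / 2) <= n%:R * (e / 2).
  by rewrite ler_wpM2l ?ler_pM2r// ltW.
rewrite (le_trans (lerD h1 h2))// -mulrDr -splitr mulrC.
Unshelve. all: by end_near.
Qed.

(** Ville's inequality with [l = 1 / sqrt N] and its opposite: for [n >= N] the
boundary [C * n / sqrt N] lies above the line of intercept
[C - sigma p ^+ 2 / 2]. The bound does not depend on the scale N. *)
Lemma csum_uniform p (C : R) N : (0 < N)%N -> sigma p ^+ 2 / 2 <= C ->
  exists F, [/\ measurable F,
    [set w | exists2 n, (N <= n)%N & C * n%:R / Num.sqrt N%:R < `|csum p 0 n w|] `<=` F
    & (P F <= (2 * expR (sigma p ^+ 2 / 2 - C))%:E)%E].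
Proof.
move=> N0 HC; set r := Num.sqrt N%:R.
have r0 : 0 < r by rewrite sqrtr_gt0 ltr0n.
have rr : r ^+ 2 = N%:R by rewrite sqr_sqrtr// ler0n.
pose a := C - sigma p ^+ 2 / 2.
pose bad l := [set w | exists n,
  a <= l * csum p 0 n w - n%:R * (l ^+ 2 * sigma p ^+ 2 / 2)].
have key n (x : R) : (N <= n)%N -> C * n%:R / r < x ->
    a <= r^-1 * x - n%:R * (r^-1 ^+ 2 * sigma p ^+ 2 / 2).
  move=> Nn Cx; have h1 : C * n%:R / r ^+ 2 <= r^-1 * x.
    by rewrite expr2 invfM mulrA mulrC ler_pM2l ?invr_gt0// ltW.
  have h2 : a <= a * (n%:R / r ^+ 2).
    rewrite ler_peMr//; first by rewrite subr_ge0.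
    by rewrite rr ler_pdivlMr ?ltr0n// mul1r ler_nat.
  apply: (le_trans h2).
  have -> : a * (n%:R / r ^+ 2) =
      C * n%:R / r ^+ 2 - n%:R * (r^-1 ^+ 2 * sigma p ^+ 2 / 2).
    by rewrite /a exprVn; ring.
  by rewrite lerD2r.
exists (bad r^-1 `|` bad (- r^-1)).
have m1 := ville_measurable p r^-1 a; have m2 := ville_measurable p (- r^-1) a.
split; first exact: measurableU.
- move=> w [n Nn]; case: (ltrP (csum p 0 n w) 0) => [s0|s0].
    rewrite ltr0_norm// => H; right; exists n.
    by have := key n _ Nn H; rewrite sqrrN mulrN mulNr.
  by rewrite ger0_norm// => H; left; exists n; exact: key.
  apply: (@le_trans _ _ (P (bad (r^-1)%R) + P (bad (- r^-1)%R))%E).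
    exact: measureU2.
  rewrite mulr2n mulrDl !mul1r EFinD.
  have -> : sigma p ^+ 2 / 2 - C = - a by rewrite /a opprB.
  by apply: leeD; exact: ville.
Qed.

(** After division by its standard deviation, the sum has the exponential moments
of a standard Gaussian, so the bound depends neither on n nor on p. *)
Lemma csum_push p a n (s x : R) : s ^+ 2 = 1 -> 0 <= x -> (0 < n)%N ->
  ((tail_bound x)%:E <=
    P [set w | (x * (sigma p * Num.sqrt n%:R) <= s * csum p a (a + n) w)%R])%E.
Proof.
move=> s1 x0 n0.
have c0 : 0 < sigma p * Num.sqrt n%:R by rewrite mulr_gt0// sqrtr_gt0 ltr0n.
rewrite (_ : [set w | _] =
    [set w | x <= s * csum p a (a + n) w / (sigma p * Num.sqrt n%:R)]); last first.
  by apply/seteqP; split => w /=; rewrite ler_pdivlMr.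
apply: gaussian_lower_tail => //.
  apply: measurable_funM => //; apply: measurable_funM => //.
  apply: (@adapted_measurable setT); exact: adapted_csum.
move=> l; set c := _ * _ in c0 *.
transitivity (\int[P]_w (expR (l * s / c * csum p a (a + n) w))%:E)%E.
  by apply: eq_integral => w _; congr (expR _)%:E; ring.
rewrite csum_mgf; congr (expR _)%:E.
rewrite !exprMn s1 exprVn /c exprMn sqr_sqrtr ?ler0n//.
by field; rewrite pnatr_eq0 -lt0n n0 gt_eqF.
Qed.

Lemma adapted_neq_cent J p n (U : T -> R) : ~ J (p, n) -> adapted J U ->
  P.-negligible [set w | U w = cent p n w].
Proof.
move=> nJ aU; have mU := adapted_measurable aU.
have aV : measurable_fun (setT : set (sigmaType X set0 [set (p, n)])) (cent p n).
  exact: adapted_cent.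
have mV : measurable_fun setT (cent p n).
  by apply: sigma_of_measurable_fun aV => A.
apply/negligibleP.
  rewrite (_ : mkset _ = (fun w => U w - cent p n w) @^-1` [set 0]).
    by rewrite -[_ @^-1` _]setTI; apply: measurable_funB.
  by apply/seteqP; split => w /=; [move=> ->; rewrite subrr|move/subr0_eq].
apply: indep_atomless_neq => //.
  apply: (adapted_indep _ aU aV); apply/eqP; apply/seteqP; split => // j [Jj] /=.
  by move=> jE; apply: nJ; rewrite -jE.
move=> x; rewrite (_ : _ @^-1` _ = X (p, n) @^-1` [set x + mu p]).
  exact: X_atomless.
by apply/seteqP; split => w; rewrite /cent /=; [move=> <-|move=> ->]; ring.
Qed.

End GaussianModel.

(** * Adaptive sampling *)

Lemma countable_bigcapT_measurable d (T : measurableType d) (U : countType)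
    (F : U -> set T) :
  (forall i, measurable (F i)) -> measurable (\bigcap_i F i).
Proof.
move=> mF; rewrite -[X in measurable X]setCK setC_bigcap; apply: measurableC.
by apply: countable_bigcupT_measurable => // i; exact: measurableC.
Qed.

Section Counting.
Context (T : Type) (k m : nat) (A : nat -> T -> 'I_k * 'I_m).

Lemma count_repS t w p :
  count_rep A t.+1 w p = (count_rep A t w p + (A t w == p))%N.
Proof. by rewrite /count_rep big_nat_recr. Qed.

Lemma count_rep_le t w p : (count_rep A t w p <= t)%N.
Proof.
elim: t => [|t IH]; first by rewrite /count_rep big_geq.
by rewrite count_repS -addn1; apply: leq_add => //; case: (_ == _).
Qed.

Lemma count_rep_mono w p t u : (t <= u)%N -> (count_rep A t w p <= count_rep A u w p)%N.
Proof.
move=> /subnKC <-; elim: (u - t)%N => [|n IH]; first by rewrite addn0.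
by rewrite addnS count_repS (leq_trans IH)// leq_addr.
Qed.

Lemma count_rep0 w p : count_rep A 0 w p = 0%N.
Proof. by rewrite /count_rep big_geq. Qed.

End Counting.

Section Adaptive.
Context d (T : measurableType d) (R : realType) (P : probability T R).
Context (k m : nat).
Local Notation E := ('I_k * 'I_m)%type.
Context (X : E * nat -> {RV P >-> R}) (G : set (set T)).
Context (A : nat -> T -> E).
Hypothesis hA : nonanticipating X A G.

(** All the replications except those of q from number N on, thought of as sealed:
independence needs events that are determined without breaking the seal. *)
Definition unsealed (q : E) (N : nat) : set (E * nat) :=
  [set j | ~ (j.1 = q /\ (N <= j.2)%N)].

Section Trace.
Variables (q : E) (N : nat).

Local Notation C := (sigmaType X G (unsealed q N)).
Local Notation Cm := (@measurable _ C).

(** On this event no sealed replication has been used by time t, as only numbers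
below the count have. *)
Let Z t : set T := [set w | (count_rep A t w q <= N)%N].

(** The sets whose trace on [Z t] is measurable are closed under complements and
countable unions, so that only the generators need an argument. *)
Lemma trace_generated t (B : set T) : Cm (Z t) ->
  (forall u p, (u < t)%N -> Cm (Z t `&` A u @^-1` [set p])) ->
  (forall u (B : set R), (u < t)%N -> measurable B ->
     Cm (Z t `&` observation X A u @^-1` B)) ->
  information X A G t B -> Cm (Z t `&` B).
Proof.
move=> mZ mA mO; move: B.
apply: smallest_sub.
  split => /=.
  - by rewrite setI0; exact: measurable0.
  - move=> B mB; rewrite setTD (_ : _ `&` _ = Z t `\` (Z t `&` B)).
      exact: (@measurableD _ C).
    apply/seteqP; split => w /=; first by move=> [Zw nB]; split => // -[].
    by move=> [Zw nB]; split => // Bw; apply: nB.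
  - by move=> F mF; rewrite setI_bigcupr; apply: (@bigcupT_measurable _ C).
move=> B [[GB|[u [p [ut ->]]]]|[u [B' [ut mB' ->]]]] /=; last 2 first.
- exact: mA.
- exact: mO.
by apply: (@measurableI _ C) => //; apply: sub_sigma_algebra; left.
Qed.

(** Induction on t: the decision at time t depends on earlier decisions and
observations, and on [Z t.+1] it yields an observation that is not sealed. The
event [Z t.+1] itself is decided before the seal is broken: it fails when q is
chosen at a time at which it already has N replications. *)
Lemma count_adapted t :
  [/\ Cm (Z t),
      forall p n, Cm (Z t `&` [set w | count_rep A t w p = n]),
      forall u p, (u < t)%N -> Cm (Z t `&` A u @^-1` [set p]) &
      forall u (B : set R), (u < t)%N -> measurable B ->
        Cm (Z t `&` observation X A u @^-1` B)].
Proof.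
elim: t => [|t [mZ mc mA mO]].
  have Z0 : Z 0 = setT by apply/seteqP; split => w //= _; rewrite /Z/= count_rep0.
  split => //; first by rewrite Z0; exact: (@measurableT _ C).
  move=> p n; rewrite Z0 setTI; case: n => [|n].
    rewrite (_ : mkset _ = setT); first exact: (@measurableT _ C).
    by apply/seteqP; split => w //= _; rewrite count_rep0.
  rewrite (_ : mkset _ = set0); first exact: (@measurable0 _ C).
  by apply/seteqP; split => w //=; rewrite count_rep0.
have mAt p : Cm (Z t `&` A t @^-1` [set p]) by apply: trace_generated => //; exact: hA.
have ZS : Z t.+1 = Z t `\`
    ((Z t `&` A t @^-1` [set q]) `&` (Z t `&` [set w | count_rep A t w q = N])).
  apply/seteqP; split => w; rewrite /Z/= count_repS.
    have [->|AA] := eqVneq (A t w) q => H; split; try lia.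
    by move=> [[_ ?] _]; case/eqP: AA.
  move=> [H1 H2]; have [Aq|_] := eqVneq (A t w) q; last by rewrite addn0.
  rewrite addn1 ltn_neqAle H1 andbT; apply/eqP => cN; apply: H2.
  by repeat split.
have mZS : Cm (Z t.+1).
  by rewrite ZS; apply: (@measurableD _ C) => //; exact: (@measurableI _ C).
have ZSt : Z t.+1 `<=` Z t by rewrite ZS => w [].
have sub (B : set T) : Cm (Z t `&` B) -> Cm (Z t.+1 `&` B).
  move=> mB; rewrite (_ : _ `&` _ = Z t.+1 `&` (Z t `&` B)).
    exact: (@measurableI _ C).
  by rewrite setIA; congr (_ `&` _); apply/esym/setIidl.
split => //.
- move=> p n.
  rewrite (_ : _ `&` _ = Z t.+1 `&`
    (((Z t `&` A t @^-1` [set p]) `&`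
       (if n is n'.+1 then Z t `&` [set w | count_rep A t w p = n'] else set0)) `|`
     ((Z t `\` (Z t `&` A t @^-1` [set p])) `&` (Z t `&` [set w | count_rep A t w p = n])))).
    apply: (@measurableI _ C) => //; apply: (@measurableU _ C).
      apply: (@measurableI _ C) => //; case: n => // ; exact: (@measurable0 _ C).
    by apply: (@measurableI _ C) => //; exact: (@measurableD _ C).
  apply/seteqP; split => w /=.
    move=> [Zw]; rewrite count_repS; have Ztw := ZSt _ Zw.
    have [Ap|Ap] := eqVneq (A t w) p.
      by case: n => [|n]; rewrite addn1// => -[cn]; split => //; left.
    rewrite addn0 => cn; split => //; right; split => //; split => //.
    by move=> [_ ?]; case/eqP: Ap.
  move=> [Zw H]; split => //; rewrite count_repS; case: H.
    by move=> [[_ ->]]; rewrite eqxx; case: n => // n [_ /= ->]; rewrite addn1.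
  move=> [[Zt nA] [_ <-]]; case: eqVneq => [Ap|_]; last by rewrite addn0.
  by case: nA.
- move=> u p; rewrite ltnS leq_eqVlt => /orP[/eqP->|ut]; first exact: sub.
  by apply: sub; exact: mA.
- move=> u B; rewrite ltnS leq_eqVlt => /orP[/eqP->|ut] mB; last first.
    by apply: sub; exact: mO.
  pose F (j : E * nat) : set T := Z t.+1 `&`
    (((Z t `&` A t @^-1` [set j.1]) `&` (Z t `&` [set w | count_rep A t w j.1 = j.2])) `&`
     (if `[< unsealed q N j >] then X j @^-1` B else set0)).
  rewrite (_ : _ `&` _ = \bigcup_j F j).
    apply: (@countable_bigcupT_measurable _ C) => // j.
    apply: (@measurableI _ C) => //; apply: (@measurableI _ C).
      exact: (@measurableI _ C).
    by case: asboolP => [Jj|_]; [exact: sigma_of_X|exact: (@measurable0 _ C)].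
  apply/seteqP; split => w /=.
    move=> [Zw]; rewrite /observation/= => Bw; have Ztw := ZSt _ Zw.
    exists (A t w, count_rep A t w (A t w)) => //; split => //; split => //.
    case: asboolP => [//|]; apply => -[/= Aq]; move: Zw.
    by rewrite /Z/= count_repS Aq eqxx; lia.
  move=> [[p n] _ [Zw [[[Zt /= <-] [_ <-]]]]]; by case: asboolP.
Qed.

End Trace.

Lemma countset_measurable p t n :
  sigma_of X G setT [set w | count_rep A t w p = n].
Proof.
have [_ mc _ _] := count_adapted p t t.
have := mc p n; rewrite (_ : _ `&` _ = [set w | count_rep A t w p = n]).
  by apply: sigma_ofS.
by apply/seteqP; split => w /=; [case|move=> H; split => //; exact: count_rep_le].
Qed.

(** The other pairs of S are required to have N replications while q has exactly
N, possibly some time after q got the N-th: the first N of q are then all that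
has been used of q. *)
Definition last_to_reach (S : {set E}) q N : set T :=
  [set w | exists t, count_rep A t w q = N /\
     forall p, p \in S -> p != q -> (N <= count_rep A t w p)%N].

Lemma last_to_reach_unsealed S q N :
  sigma_of X G (unsealed q N) (last_to_reach S q N).
Proof.
pose C := sigmaType X G (unsealed q N).
pose Z t : set T := [set w | (count_rep A t w q <= N)%N].
pose F t p : set T := \bigcup_n
  (if (N <= n)%N then Z t `&` [set w | count_rep A t w p = n] else set0).
have mF t p : @measurable _ C (F t p).
  apply: (@bigcupT_measurable _ C) => n; case: ifP => _; last exact: (@measurable0 _ C).
  by have [_ + _ _] := count_adapted q N t; apply.
rewrite (_ : last_to_reach S q N = \bigcup_t
   ((Z t `&` [set w | count_rep A t w q = N]) `&`
     \bigcap_(p : E) (if (p \in S) && (p != q) then F t p else setT))).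
  apply: (@bigcupT_measurable _ C) => t; apply: (@measurableI _ C).
    by have [_ + _ _] := count_adapted q N t; apply.
  apply: (@countable_bigcapT_measurable _ C) => p.
  by case: ifP => _; [exact: mF|exact: (@measurableT _ C)].
apply/seteqP; split => w.
  move=> [t [cq H]]; exists t => //; split; first by split => //=; rewrite /Z/= cq.
  move=> p _; case: ifP => // /andP[pS pq]; exists (count_rep A t w p) => //.
  by rewrite (H _ pS pq); split => //=; rewrite /Z/= cq.
move=> [t _ [[Zw /= cq] H]]; exists t; split => // p pS pq.
have := H p I; rewrite pS pq => -[n _]; case: ifP => // Nn [_ /= ->]; exact: Nn.
Qed.

(** At the first time at which every pair of S has N replications, one of them has
just received its N-th. *)
Lemma last_to_reach_exists (S : {set E}) p0 N w : (0 < N)%N -> p0 \in S ->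
  (forall p, p \in S -> forall M, exists t, (M <= count_rep A t w p)%N) ->
  exists2 q, q \in S & last_to_reach S q N w.
Proof.
move=> N0 p0S inf.
have [f Hf] : exists f : E -> nat, forall p, p \in S -> (N <= count_rep A (f p) w p)%N.
  have H p : exists t, p \in S -> (N <= count_rep A t w p)%N.
    have [pS|_] := boolP (p \in S); last by exists 0%N.
    by have [t Ht] := inf p pS N; exists t.
  have [f Hf] := choice H; by exists f.
pose all_reached t := [forall p, (p \in S) ==> (N <= count_rep A t w p)%N].
have ex : exists t, all_reached t.
  exists (\max_p f p); apply/forallP => p; apply/implyP => pS.
  by apply: (leq_trans (Hf p pS)); apply: count_rep_mono; exact: leq_bigmax.
have := ex_minnP ex => -[t /forallP ct tmin].
have ctS p : p \in S -> (N <= count_rep A t w p)%N by move=> pS; have /implyP := ct p; apply.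
have t0 : (0 < t)%N.
  by case: t ctS {ct tmin} => // /(_ p0 p0S); rewrite count_rep0; lia.
have : ~~ all_reached t.-1 by apply/negP => /tmin; lia.
rewrite negb_forall => /existsP[q]; rewrite negb_imply -ltnNge => /andP[qS cq].
exists q => //; exists t; split; last by move=> p pS _; exact: ctS.
have := ctS _ qS; move: cq; rewrite -(prednK t0) count_repS /=.
by case: (_ == _); lia.
Qed.

End Adaptive.

Section Approximation.
Context d (T : measurableType d) (R : realType) (P : probability T R).
Context (E : eqType) (X : E * nat -> {RV P >-> R}) (G : set (set T)).
Hypotheses (hG : sigma_algebra setT G) (hGm : G `<=` measurable).

Definition before (N : nat) : set (E * nat) := [set j | (j.2 < N)%N].

Let approximable (F : set T) := measurable F /\ forall e : R, 0 < e ->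
  exists N B, [/\ sigma_of X G (before N) B, (P (F `\` B) <= e%:E)%E &
    (P (B `\` F) <= e%:E)%E].

(** A cylinder involves finitely many replications, and approximation passes to
proper differences and to increasing unions: the pi-lambda theorem applies. *)
Lemma approximable_sigma F : sigma_of X G setT F -> forall e : R, 0 < e ->
  exists N B, [/\ sigma_of X G (before N) B, (P (F `\` B) <= e%:E)%E &
    (P (B `\` F) <= e%:E)%E].
Proof.
suff H : sigma_of X G setT `<=` approximable by move=> /H[].
clear F.
have beforeM N M : (N <= M)%N -> sigma_of X G (before N) `<=` sigma_of X G (before M).
  by move=> NM; apply: sigma_ofS => // j; rewrite /before/= => /leq_trans; apply.
have mS N B : sigma_of X G (before N) B -> measurable B by exact: sigma_of_measurable.
have GT := sigma_algebra_setT hG; have GI := sigma_algebra_setI hG.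
apply: (@subset_trans _ <<s observed_pi X G setT >>).
  by apply: sub_sigma_algebra2; exact: observed_sub_pi.
apply: lambda_system_subset => //; first exact: setI_closed_observed_pi.
- split => //.
  + split => // e e0; exists 0%N, setT; rewrite setDv measure0 lee_fin ltW//.
    by split => //; apply: sub_sigma_algebra; left.
  + move=> A B BA [mA HA] [mB HB]; split; first exact: measurableD.
    move=> e e0; have e2 : 0 < e / 2 by rewrite divr_gt0.
    have [N [A' [sA A1 A2]]] := HA _ e2.
    have [M [B' [sB B1 B2]]] := HB _ e2.
    have mA' := mS _ _ sA; have mB' := mS _ _ sB.
    exists (maxn N M), (A' `\` B').
    have le2 U V W : measurable U -> measurable V -> measurable W -> W `<=` U `|` V ->
        (P U <= (e / 2)%:E)%E -> (P V <= (e / 2)%:E)%E -> (P W <= e%:E)%E.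
      move=> mU mV mW WUV PU PV; apply: (@le_trans _ _ (P (U `|` V))).
        by apply: le_measure; rewrite ?inE//; exact: measurableU.
      apply: (@le_trans _ _ (P U + P V)%E); first exact: measureU2.
      by rewrite (splitr e) EFinD; exact: leeD.
    split.
    * apply: (@measurableD _ (sigmaType X G (before (maxn N M)))).
        by apply: beforeM sA; rewrite leq_maxl.
      by apply: beforeM sB; rewrite leq_maxr.
    * apply: (le2 _ _ _ _ _ _ _ A1 B2); try by repeat apply: measurableD.
      move=> w [[Aw nBw] nAB]; have [A'w|] := pselect (A' w); last by left.
      by right; split => //; apply: contrapT => nB'; apply: nAB.
    * apply: (le2 _ _ _ _ _ _ _ A2 B1); try by repeat apply: measurableD.
      move=> w [[A'w nB'w] nAB]; have [Aw|] := pselect (A w); last by left.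
      by right; split => //; apply: contrapT => nB; apply: nAB.
  + move=> F ndF HF; have mF i : measurable (F i) by have [] := HF i.
    have mU : measurable (\bigcup_i F i) by exact: bigcupT_measurable.
    split => // e e0; have e2 : 0 < e / 2 by rewrite divr_gt0.
    have cv := nondecreasing_cvg_mu (mu := P) mF mU ndF.
    have [n Pn] : exists n, (P (\bigcup_i F i `\` F n) <= (e / 2)%:E)%E.
      have fin V : measurable V -> P V \is a fin_num by exact: fin_num_measure.
      have cvf : (P \o F) i @[i --> \oo] --> (fine (P (\bigcup_i F i)))%:E.
        by rewrite fineK ?fin//; exact: cv.
      have cvf2 : fine (P (F i)) @[i --> \oo] --> fine (P (\bigcup_i F i)).
        exact: fine_cvg cvf.
      move/cvgrPdist_le : cvf2 => /(_ _ e2)[n _ Hn0].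
      have {Hn0} /= Hn := Hn0 n (leqnn n).
      exists n; have -> : P (\bigcup_i F i `\` F n) =
          (fine (P (\bigcup_i F i)) - fine (P (F n)))%:E.
        rewrite EFinB !fineK ?fin// measureD//.
          by rewrite setIidr// => w Fw; exists n.
        by rewrite (le_lt_trans (probability_le1 P mU))// ltry.
      by rewrite lee_fin; apply: le_trans Hn; exact: ler_norm.
    have [_ HFn] := HF n; have [N [B [sB B1 B2]]] := HFn _ e2.
    have mB := mS _ _ sB.
    exists N, B; split => //.
      apply: (@le_trans _ _ (P ((\bigcup_i F i `\` F n) `|` (F n `\` B)))).
        apply: le_measure; rewrite ?inE//; first exact: measurableD.
          by apply: measurableU; exact: measurableD.
        move=> w [Uw nB]; have [Fw|] := pselect (F n w); [by right|by left].
      apply: (@le_trans _ _ (P (\bigcup_i F i `\` F n) + P (F n `\` B))%E).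
        by apply: measureU2; exact: measurableD.
      by rewrite (splitr e) EFinD; exact: leeD.
    apply: (@le_trans _ _ (P (B `\` F n))).
      apply: le_measure; rewrite ?inE//; try exact: measurableD.
      by move=> w [Bw nU]; split => // Fw; apply: nU; exists n.
    by apply: (le_trans B2); rewrite lee_fin ler_pdivrMr// ler_peMr ?ler1n// ltW.
- move=> _ [g [L [B [Gg uL _ mB ->]]]]; split.
    by apply: measurableI; [exact: hGm|exact: measurable_cylinder].
  move=> e e0; exists (\max_(j <- L) j.2).+1, (g `&` cylinder X L B).
  rewrite !setDv measure0 lee_fin ltW//; split => //.
  apply: (@measurableI _ (sigmaType X G (before _))).
    by apply: sub_sigma_algebra; left.
  have : forall j, j \in L -> (j.2 < (\max_(j <- L) j.2).+1)%N.
    by move=> j jL; rewrite ltnS; exact: leq_bigmax_seq.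
  move: (_.+1) => N {uL}; elim: L => [|j L IH] HL.
    rewrite (_ : cylinder X [::] B = setT); last by apply/seteqP; split.
    exact: (@measurableT _ (sigmaType X G (before _))).
  rewrite cylinder_cons; apply: (@measurableI _ (sigmaType X G (before _))).
    by apply: sigma_of_X => //; apply: HL; rewrite inE eqxx.
  by apply: IH => i iL; apply: HL; rewrite inE iL orbT.
Qed.

End Approximation.

(** * Recurrence of large deviations under adaptive sampling *)

Section Recurrence.
Context d (T : measurableType d) (R : realType) (P : probability T R).
Context (k m : nat).
Local Notation E := ('I_k * 'I_m)%type.
Context (X : E * nat -> {RV P >-> R}) (mu sigma : E -> R).
Context (G : set (set T)).
Hypotheses (hG : sigma_algebra setT G) (hGm : G `<=` measurable).
Hypotheses (hXG : independent_of X G) (hXindep : mutually_independent X).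
Hypothesis sigma_gt0 : forall p, 0 < sigma p.
Hypothesis hXlaw : forall p n (B : set R), measurable B ->
  distribution P (X (p, n)) B = normal_prob (mu p) (sigma p) B.
Context (A : nat -> T -> E).
Hypothesis hA : nonanticipating X A G.

Local Notation csum := (csum X mu).
Local Notation S_of J := (sigma_of X G J).

Lemma sigma_of_le G' J (f : T -> R) c :
  measurable_fun (setT : set (sigmaType X G' J)) f ->
  sigma_of X G' J [set w | f w <= c].
Proof.
move=> mf; rewrite (_ : mkset _ = f @^-1` `]-oo, c]); first exact: sigma_of_fun.
by apply/seteqP; split => w; rewrite /= in_itv.
Qed.

Lemma measure_bigsetU_le (I : Type) (r : seq I) (F : I -> set T) :
  (forall i, measurable (F i)) ->
  (P (\big[setU/set0]_(i <- r) F i) <= \sum_(i <- r) P (F i))%E.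
Proof.
move=> mF; elim: r => [|i r IH]; first by rewrite !big_nil measure0.
rewrite !big_cons; apply: le_trans (leeD _ IH); last by [].
by apply: measureU2 => //; apply: bigsetU_measurable.
Qed.

(** A sum of order [n / sqrt N] moves the mean of n replications by the order of
[1 / sqrt N], the size of the fluctuations at scale N, for all later times at
once. *)
Definition quiet (N : nat) (C : R) p : set T :=
  [set w | forall n, (N <= n)%N -> `|csum p 0 n w| <= C * n%:R / Num.sqrt N%:R].

(** All that is required at scale N, apart from the replications N to 2 N - 1 of
q. *)
Definition calm (S : {set E}) q N C : set T :=
  (last_to_reach A S q N `&` [set w | `|csum q 0 N w| <= C * N%:R / Num.sqrt N%:R]) `&`
  \bigcap_(p : E) (if (p \in S) && (p != q) then quiet N C p else setT).

Definition push (s : R) q N x : set T :=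
  [set w | x * (sigma q * Num.sqrt N%:R) <= s * csum q N (N + N) w].

Lemma quiet_sigma J N C p : (forall i, J (p, i)) -> S_of J (quiet N C p).
Proof.
move=> Jp; rewrite (_ : quiet N C p = \bigcap_n
  (if (N <= n)%N then [set w | `|csum p 0 n w| <= C * n%:R / Num.sqrt N%:R] else setT)).
  apply: (@bigcapT_measurable _ (sigmaType X G J)) => n.
  case: ifP => _; last exact: (@measurableT _ (sigmaType X G J)).
  apply: sigma_of_le; apply: measurableT_comp => //.
  by rewrite -[n]add0n; apply: adapted_csum.
apply/seteqP; split => w H.
  by move=> n _; case: ifP => // /H.
by move=> n Nn; have := H n I; rewrite Nn.
Qed.

Lemma calm_sigma S q N C : S_of (unsealed q N) (calm S q N C).
Proof.
pose TT := sigmaType X G (unsealed q N).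
apply: (@measurableI _ TT); first apply: (@measurableI _ TT).
- exact: last_to_reach_unsealed.
- apply: sigma_of_le; apply: measurableT_comp => //.
  rewrite -[N in csum _ _ N]add0n; apply: adapted_csum => i /= iN [_] /=; lia.
- apply: (@countable_bigcapT_measurable _ TT) => p.
  case: ifP => [/andP[_ pq]|_]; last exact: (@measurableT _ TT).
  by apply: quiet_sigma => i [/= pE]; rewrite pE eqxx in pq.
Qed.

Lemma push_sigma s q N x :
  sigma_of X set0 [set j | j.1 = q /\ (N <= j.2)%N] (push s q N x).
Proof.
rewrite (_ : push s q N x =
    [set w | - (s * csum q N (N + N) w) <= - (x * (sigma q * Num.sqrt N%:R))]).
  apply: sigma_of_le; apply: measurableT_comp => //; apply: measurable_funM => //.
  by apply: adapted_csum => i /andP[Ni _].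
by apply/seteqP; split => w; rewrite /push/= lerN2.
Qed.

(** Calmness and B are decided without the sealed replications of q, so a push
keeps its full probability conditionally on both. *)
Lemma calm_push_le S q N C s x B : S_of (unsealed q N) B -> s ^+ 2 = 1 ->
  0 <= x -> (0 < N)%N ->
  (P (calm S q N C `&` B) * (tail_bound x)%:E <=
   P (calm S q N C `&` push s q N x `&` B))%E.
Proof.
move=> mB s1 x0 N0; rewrite setIAC.
have -> : P (calm S q N C `&` B `&` push s q N x) =
    (P (calm S q N C `&` B) * P (push s q N x))%E.
  apply: (@sigma_of_indep _ _ _ _ _ X hXindep G (unsealed q N)
     [set j | j.1 = q /\ (N <= j.2)%N]) => //.
  - by apply/eqP; apply/seteqP; split => // j [].
  - by apply: (@measurableI _ (sigmaType X G (unsealed q N))) => //; exact: calm_sigma.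
  - exact: push_sigma.
apply: lee_pmul => //; first by rewrite lee_fin ltW// tail_bound_gt0.
exact: (csum_push hG hGm hXG hXindep sigma_gt0 hXlaw).
Qed.

Section Fixed.
Variables (S : {set E}) (s : E -> R) (xf : nat -> R) (p0 : E).
Hypotheses (p0S : p0 \in S) (s1 : forall q, s q ^+ 2 = 1) (xf0 : forall C, 0 <= xf C).

Let all_infinite : set T :=
  [set w | forall p, p \in S -> forall M, exists t, (M <= count_rep A t w p)%N].

Let avoid (C N0 : nat) : set T := all_infinite `&`
  [set w | forall N, (N0 <= N)%N -> (0 < N)%N -> forall q, q \in S ->
     ~ (calm S q N C%:R w /\ push (s q) q N (xf C) w)].

Let SM J : S_of J `<=` measurable.
Proof. exact: sigma_of_measurable. Qed.

Let ST := sigmaType X G setT.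

Let calm_all q N C : S_of setT (calm S q N C).
Proof. by have := @calm_sigma S q N C; apply: sigma_ofS. Qed.

Let push_all t q N x : S_of setT (push t q N x).
Proof. by have := @push_sigma t q N x; apply: sigma_ofS. Qed.

Let avoid_sigma C N0 : S_of setT (avoid C N0).
Proof.
apply: (@measurableI _ ST).
  rewrite (_ : all_infinite = \bigcap_(pM : E * nat)
     (if pM.1 \in S then \bigcup_(tn : nat * nat)
        (if (pM.2 <= tn.2)%N then [set w | count_rep A tn.1 w pM.1 = tn.2] else set0)
      else setT)).
    apply: (@countable_bigcapT_measurable _ ST) => -[p M] /=.
    case: ifP => _; last exact: (@measurableT _ ST).
    apply: (@countable_bigcupT_measurable _ ST) => // -[t n] /=.
    by case: ifP => _; [exact: countset_measurable|exact: (@measurable0 _ ST)].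
  apply/seteqP; split => w.
    move=> H [p M] _ /=; case: ifP => // pS; have [t Ht] := H p pS M.
    by exists (t, count_rep A t w p) => //=; rewrite Ht.
  move=> H p pS M; have := H (p, M) I; rewrite /= pS => -[[t n] _] /=.
  by case: ifP => // Mn /= cE; exists t; rewrite cE.
rewrite (_ : mkset _ = \bigcap_(Nq : nat * E)
  (if [&& (N0 <= Nq.1)%N, (0 < Nq.1)%N & Nq.2 \in S] then
     ~` (calm S Nq.2 Nq.1 C%:R `&` push (s Nq.2) Nq.2 Nq.1 (xf C)) else setT)).
  apply: (@countable_bigcapT_measurable _ ST) => -[N q] /=.
  case: ifP => _; last exact: (@measurableT _ ST).
  apply: (@measurableC _ ST); apply: (@measurableI _ ST).
    exact: calm_all.
  exact: push_all.
apply/seteqP; split => w.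
  by move=> H [N q] _ /=; case: ifP => // /and3P[? ? ?]; exact: H.
by move=> H N NN N0' q qS; have := H (N, q) I; rewrite /= NN N0' qS.
Qed.

(** Replace the event by an approximation B that involves replications of numbers
below N only, hence no sealed one at the scale N. If B and calmness for q had a
large joint probability, then so would the same followed by a push of q; but
this lies outside of the event and has a small probability as a subset of B. On
the other hand some pair is always last to reach N, and then calmness can only
fail if one of the sums is not quiet, which has a small probability. *)
Lemma avoid_le C N0 (del : R) : 0 < del ->
  (forall p, sigma p ^+ 2 / 2 <= C%:R) ->
  (forall p, 2 * expR (sigma p ^+ 2 / 2 - C%:R) <= del) ->
  (P (avoid C N0) <= (#|{: E}|%:R * del)%:E)%E.
Proof.
move=> del0 C1 C2; apply/lee_addgt0Pr => e e0.
set c := tail_bound (xf C); have c0 : 0 < c := tail_bound_gt0 _.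
set n := #|{: E}|.
(* The approximation costs e1, and the part of B that is calm for some q costs
   e1 / c for each of the n pairs: e1 is chosen so that they sum to e. *)
have nc0 : 0 < 1 + n%:R / c by rewrite ltr_pwDl// divr_ge0// ltW.
pose e1 := e / (1 + n%:R / c); have e10 : 0 < e1 by rewrite divr_gt0.
have [N1 [B [sB PB1 PB2]]] := approximable_sigma hG hGm (avoid_sigma C N0) e10.
pose N := maxn (maxn N0 N1) 1.
have N_gt0 : (0 < N)%N by rewrite /N; lia.
have N0N : (N0 <= N)%N by rewrite /N; lia.
have N1N : (N1 <= N)%N by rewrite /N; lia.
have mB := SM sB; have mO := SM (avoid_sigma C N0).
have mcalm q : measurable (calm S q N C%:R) by exact: SM (@calm_sigma _ _ _ _).
have mpush q : measurable (push (s q) q N (xf C)).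
  exact: SM (@push_all _ _ _ _).
have sBq q : S_of (unsealed q N) B.
  move: sB; apply: sigma_ofS => // j; rewrite /before/= => jN [_].
  by rewrite leqNgt (leq_trans jN).
have PZ q : q \in S -> (P (calm S q N C%:R `&` B) <= (e1 / c)%:E)%E.
  move=> qS.
  have := calm_push_le S C%:R (sBq q) (s1 q) (xf0 C) N_gt0.
  rewrite -/c => /le_trans -/(_ e1%:E) H.
  have fP : P (calm S q N C%:R `&` B) \is a fin_num.
    by apply: fin_num_measure; exact: measurableI.
  rewrite -(fineK fP) lee_fin ler_pdivlMr// -lee_fin EFinM fineK//.
  apply: H; apply: le_trans PB2; apply: le_measure; rewrite ?inE.
  - by apply: measurableI => //; exact: measurableI.
  - exact: measurableD.
  - by move=> w [[cw pw] Bw]; split => // -[_ /(_ N N0N N_gt0 q qS)]; apply.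
have [Bad HBad] := choice (fun p =>
  csum_uniform hG hGm hXG hXindep sigma_gt0 hXlaw N_gt0 (C1 p)).
pose FZ q := if q \in S then calm S q N C%:R `&` B else set0.
have mFZ q : measurable (FZ q) by rewrite /FZ; case: ifP => // _; exact: measurableI.
have mBad p : measurable (Bad p) by have [] := HBad p.
pose U1 := \big[setU/set0]_(q : E) FZ q.
pose U2 := \big[setU/set0]_(p : E) Bad p.
have mU1 : measurable U1 by exact: bigsetU_measurable.
have mU2 : measurable U2 by exact: bigsetU_measurable.
have cover : avoid C N0 `<=` (avoid C N0 `\` B) `|` (U1 `|` U2).
  move=> w Ow; have [Bw|] := pselect (B w); last by left; split.
  right; have [Uw|nU2] := pselect (U2 w); [by right|left].
  have quiet_w p n' : (N <= n')%N -> `|csum p 0 n' w| <= C%:R * n'%:R / Num.sqrt N%:R.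
    move=> Nn; rewrite leNgt; apply/negP => lt; apply: nU2.
    rewrite /U2 -bigcup_seq; exists p; first by rewrite /= mem_index_enum.
    by have [_ + _] := HBad p; apply; exists n'.
  have [infw _] := Ow.
  have [q qS lq] := last_to_reach_exists N_gt0 p0S infw.
  rewrite /U1 -bigcup_seq; exists q; first by rewrite /= mem_index_enum.
  rewrite /FZ qS; split => //; split; first by split => //; exact: quiet_w.
  by move=> p _; case: ifP => // _ n'; exact: quiet_w.
have PU1 : (P U1 <= (n%:R * (e1 / c))%:E)%E.
  apply: (le_trans (measure_bigsetU_le _ mFZ)).
  apply: (@le_trans _ _ (\sum_(q : E) (e1 / c)%:E)%E).
    apply: lee_sum => q _; rewrite /FZ; case: ifP => [/PZ//|_].
    by rewrite measure0 lee_fin divr_ge0// ltW.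
  by rewrite sumEFin lee_fin sumr_const -[X in X <= _]mulr_natl.
have PU2 : (P U2 <= (n%:R * del)%:E)%E.
  apply: (le_trans (measure_bigsetU_le _ mBad)).
  apply: (@le_trans _ _ (\sum_(q : E) del%:E)%E).
    apply: lee_sum => q _; have [_ _ h] := HBad q.
    by apply: (le_trans h); rewrite lee_fin.
  by rewrite sumEFin lee_fin sumr_const -[X in X <= _]mulr_natl.
apply: (@le_trans _ _ (P ((avoid C N0 `\` B) `|` (U1 `|` U2)))).
  apply: le_measure; rewrite ?inE//; apply: measurableU; first exact: measurableD.
  exact: measurableU.
apply: (@le_trans _ _ (P (avoid C N0 `\` B) + (P U1 + P U2))%E).
  apply: (@le_trans _ _ (P (avoid C N0 `\` B) + P (U1 `|` U2))%E).
    by apply: measureU2; [exact: measurableD|exact: measurableU].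
  by apply: leeD => //; exact: measureU2.
apply: (@le_trans _ _ (e1%:E + ((n%:R * (e1 / c))%:E + (n%:R * del)%:E))%E).
  by apply: leeD => //; exact: leeD.
rewrite -!EFinD lee_fin addrA addrC lerD2l.
have -> : e1 + n%:R * (e1 / c) = e1 * (1 + n%:R / c) by ring.
by rewrite /e1 divfK// gt_eqF.
Qed.

(** For each C the exceptional set lies in the union over N0 of the events
[avoid C N0], and the bound on their probabilities tends to zero as C grows,
whatever the sizes [xf C] of the pushes. *)
Lemma push_recurrence : P.-negligible
  [set w | all_infinite w /\ forall C : nat, exists N0, forall N, (N0 <= N)%N ->
     (0 < N)%N -> forall q, q \in S ->
     ~ (calm S q N C%:R w /\ push (s q) q N (xf C) w)].
Proof.
apply: negligible_small => e e0; set n := #|{: E}|.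
have n0 : (0 < n)%N by apply/card_gt0P; exists p0.
have n0R : 0 < n%:R :> R by rewrite ltr0n.
pose del := e / n%:R; have del0 : 0 < del by rewrite divr_gt0.
pose bnd p := sigma p ^+ 2 / 2 + `|ln (2 / del)|.
pose C := (\max_(p : E) (Num.truncn (bnd p)).+1)%N.
have bC p : bnd p <= C%:R.
  apply: (le_trans (ltW (truncnS_gt _))); rewrite ler_nat.
  exact: (leq_bigmax (F := fun p => (Num.truncn (bnd p)).+1)).
exists (\bigcup_N0 avoid C N0); split.
- by apply: bigcupT_measurable => N0; exact: SM (avoid_sigma _ _).
- move=> w [iw /(_ C)[N0 H]]; exists N0 => //; split => //.
- apply: measure_nondecreasing_bigcup_le => [N0|N0|N0].
  + exact: SM (avoid_sigma _ _).
  + move=> w [iw H]; split => // N NN; apply: H; exact: ltnW.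
  + apply: (le_trans (@avoid_le C N0 del del0 _ _)).
    * move=> p; apply: le_trans (bC p); by rewrite /bnd lerDl.
    * move=> p; have d2 : 0 < 2 / del by rewrite divr_gt0.
      rewrite -ler_pdivlMl// -[X in _ <= X]invrK invfM invrK -[_ / del]lnK ?posrE//.
      rewrite -expRN ler_expR.
      have := bC p; have := ler_norm (ln (2 / del)); rewrite /bnd; lra.
    * by rewrite lee_fin /del mulrC divfK// gt_eqF.
Qed.

End Fixed.
End Recurrence.

(** * The policy as a comparison of edges *)

Section Edges.
Context (R : realType) (k m : nat).
Local Notation E := ('I_k * 'I_m)%type.
Implicit Types (e : E * E) (p q : E).

(** Edges are the comparisons that enter the policy: of a scenario of the
alternative b with the posterior worst scenario of another alternative. *)
Definition is_edge (D : 'I_k -> 'I_m) (b : 'I_k) e : bool :=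
  [&& e.1.1 == b, e.2.1 != b & e.2.2 == D e.2.1].

Section Value.
Context (M S S' : 'I_k -> 'I_m -> R) (D : 'I_k -> 'I_m) (b : 'I_k).

Let var q p : R := if q == p then S' p.1 p.2 else S p.1 p.2.

Definition edge_value q e : R :=
  (M e.1.1 e.1.2 - M e.2.1 e.2.2) ^+ 2 / (var q e.1 + var q e.2).

(** Together with [value_ge_edge]: the value of a candidate is the minimum over the
edges, and the case distinction in its definition only singles out the edges
that end at the candidate. *)
Lemma value_le_edge q e : candidate D b q -> is_edge D b e ->
  (value M S S' D b q <= (edge_value q e)%:E)%E.
Proof.
case: e => -[bl l] [i d] cq /and3P[/= /eqP -> ib /eqP ->].
case: q cq => j s; rewrite /candidate/= /value/= /edge_value/= /var /=.
have [->{j} _|jb /= /eqP ->] := eqVneq j b.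
  rewrite /value_best !xpair_eqE eqxx/= (negbTE (_ : b != i)) 1?eq_sym//=.
  have [->|ls] := eqVneq s l.
    by rewrite ge_min; apply/orP; left; exact: bigmin_le_cond.
  rewrite ge_min; apply/orP; right.
  apply: le_trans; first by apply: (@Order.TotalTheory.bigmin_le_cond _ _ _ _ l); rewrite eq_sym.
  apply: le_trans; first exact: (@Order.TotalTheory.bigmin_le_cond _ _ _ _ i).
  by [].
rewrite /value_other !xpair_eqE (negbTE jb)/= ge_min.
have [->|ji] := eqVneq j i.
  by rewrite eqxx/=; apply/orP; left; exact: bigmin_le.
rewrite /=; apply/orP; right.
apply: le_trans; first exact: (bigmin_le _ l).
by apply: (@Order.TotalTheory.bigmin_le_cond _ _ _ _ i); rewrite ib eq_sym.
Qed.

Lemma value_ge_edge q x : candidate D b q ->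
  (forall e, is_edge D b e -> x <= edge_value q e) ->
  (x%:E <= value M S S' D b q)%E.
Proof.
case: q => j s cq H; rewrite /value/=.
have [jb|jb] := eqVneq j b.
  subst j; rewrite /value_best le_min; apply/andP; split.
    apply: le_bigmin => [|i ib]; first exact: leey.
    have := H ((b, s), (i, D i)).
    rewrite /is_edge/= !eqxx ib => /(_ isT).
    by rewrite /edge_value/var/= eqxx xpair_eqE (negbTE (_ : b != i)) 1?eq_sym// lee_fin.
  apply: le_bigmin => [|l ls]; first exact: leey.
  apply: le_bigmin => [|i ib]; first exact: leey.
  have := H ((b, l), (i, D i)).
  rewrite /is_edge/= !eqxx ib => /(_ isT).
  rewrite /edge_value/var/= !xpair_eqE (negbTE (_ : b != i)) 1?eq_sym// lee_fin.
  by rewrite (negbTE ls) andbF.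
move: cq; rewrite /candidate/= (negbTE jb)/= => /eqP sD; rewrite sD.
rewrite /value_other le_min; apply/andP; split.
  apply: le_bigmin => [|l _]; first exact: leey.
  have := H ((b, l), (j, D j)).
  rewrite /is_edge/= !eqxx jb => /(_ isT).
  by rewrite /edge_value/var/= !xpair_eqE (negbTE jb) sD !eqxx lee_fin.
apply: le_bigmin => [|l _]; first exact: leey.
apply: le_bigmin => [|i /andP[ib ij]]; first exact: leey.
have := H ((b, l), (i, D i)).
rewrite /is_edge/= !eqxx ib => /(_ isT).
by rewrite /edge_value/var/= !xpair_eqE (negbTE jb) (negbTE (_ : j != i)) 1?eq_sym// lee_fin.
Qed.

(** For e' take an edge at which the value of q is attained. *)
Lemma raoda_choice_edge a q e0 : raoda_choice M S S' D b a -> candidate D b q ->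
  is_edge D b e0 ->
  exists2 e', is_edge D b e' &
    forall e, is_edge D b e -> edge_value q e' <= edge_value a e.
Proof.
move=> [ca Ha] cq ed0.
have [e' ed' Hmin] := Order.TotalTheory.arg_minP (edge_value q) ed0.
exists e' => // e ed; rewrite -lee_fin.
apply: le_trans (value_le_edge ca ed); apply: le_trans (Ha _ cq).
exact: value_ge_edge.
Qed.

End Value.
End Edges.

(** * Almost sure absence of ties *)

Section Countable.
Context d (T : measurableType d) (R : realType) (P : {measure set T -> \bar R}).

Lemma negligible_countable_bigcup (I : countType) (F : I -> set T) :
  (forall i, P.-negligible (F i)) -> P.-negligible (\bigcup_i F i).
Proof.
move=> H; apply: (@negligibleS _ _ _ P
    (\bigcup_n (if unpickle n is Some i then F i else set0))).
  by move=> w [i _ Fw]; exists (pickle i) => //; rewrite pickleK.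
apply: negligible_bigcup => n; case: (unpickle n) => [i|]; first exact: H.
exact: negligible_set0.
Qed.

End Countable.

Section Ties.
Context d (T : measurableType d) (R : realType) (P : probability T R).
Context (k m : nat).
Local Notation E := ('I_k * 'I_m)%type.
Context (X : E * nat -> {RV P >-> R}) (mu sigma mu0 sigma0 : 'I_k -> 'I_m -> R).
Context (G : set (set T)).
Hypotheses (hG : sigma_algebra setT G) (hGm : G `<=` measurable).
Hypotheses (hXG : independent_of X G) (hXindep : mutually_independent X).
Hypothesis sigma_gt0 : forall i d, 0 < sigma i d.
Hypothesis sigma0_gt0 : forall i d, 0 < sigma0 i d.
Hypothesis hXlaw : forall i d n (B : set R), measurable B ->
  distribution P (X ((i, d), n)) B = normal_prob (mu i d) (sigma i d) B.

Definition truth (p : E) : R := mu p.1 p.2.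
Definition noise (p : E) : R := sigma p.1 p.2.
Definition pvar (p : E) (n : nat) : R := var_after sigma0 sigma n p.1 p.2.

Definition pmean (p : E) (n : nat) (w : T) : R :=
  pvar p n * (mu0 p.1 p.2 / sigma0 p.1 p.2 ^+ 2 +
     (csum X truth p 0 n w + n%:R * truth p) / noise p ^+ 2).

Lemma post_meanE (A : nat -> T -> E) t w i d' :
  post_mean X A mu0 sigma0 sigma t w i d' = pmean (i, d') (count_rep A t w (i, d')) w.
Proof.
rewrite /post_mean /pmean /post_var /pvar /sample_mean /=.
set n := count_rep _ _ _ _; congr (_ * (_ + _ / _)).
have -> : csum X truth (i, d') 0 n w + n%:R * truth (i, d') =
    \sum_(0 <= j < n) X ((i, d'), j) w.
  rewrite /csum /cent sumrB big_const_nat iter_addr addr0 subn0 -[X in - X]mulr_natl.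
  by rewrite subrK.
have [->|n0] := eqVneq n 0%N; first by rewrite big_geq// mul0r.
by rewrite mulrCA divff ?mulr1// pnatr_eq0.
Qed.

Lemma pvar_gt0 p n : 0 < pvar p n.
Proof.
by rewrite /pvar/var_after invr_gt0 ltr_pwDl ?invr_gt0 ?exprn_gt0// divr_ge0 ?sqr_ge0.
Qed.

Lemma pvar_decr p n : pvar p n.+1 < pvar p n.
Proof.
have h := pvar_gt0 p n; have h1 := pvar_gt0 p n.+1.
rewrite -ltf_pV2 ?posrE// /pvar/var_after !invrK ltrD2l ltr_pM2r ?ltr_nat//.
by rewrite invr_gt0 exprn_gt0.
Qed.

(** The posterior mean at the end of times of a pair that stops after n
replications, for [Some n], or of one that does not stop, for [None]. *)
Definition limit_mean (o : option nat) (p : E) (w : T) : R :=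
  if o is Some n then pmean p n w else truth p.
Definition limit_var (o : option nat) (p : E) : R :=
  if o is Some n then pvar p n else 0.

Lemma limit_mean_adapted J o p : (forall n, J (p, n)) ->
  measurable_fun (setT : set (sigmaType X G J)) (limit_mean o p).
Proof.
move=> Jp; case: o => [n|]; last exact: measurable_cst.
apply: measurable_funM => //; apply: measurable_funD => //.
apply: measurable_funM => //; apply: measurable_funD => //.
by rewrite -[n]add0n; apply: adapted_csum.
Qed.

(** The first replication of p enters the posterior mean of p with a nonzero
coefficient; its law is atomless, and it is independent of all the rest. *)
Lemma pmean_neq_adapted p n (U : T -> R) : (0 < n)%N ->
  measurable_fun (setT : set (sigmaType X G [set j | j.1 != p])) U ->
  P.-negligible [set w | pmean p n w = U w].
Proof.
case: n => // n _ mU.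
pose J : set (E * nat) := [set j | j <> (p, 0%N)].
have mU' : measurable_fun (setT : set (sigmaType X G J)) U.
  move=> _ B mB; rewrite setTI.
  apply: (@sigma_ofS _ _ _ _ _ X G G [set j | j.1 != p]) => //.
    by move=> -[q i] /= + [qp _]; rewrite qp eqxx.
  exact: sigma_of_fun.
pose V w := (U w / pvar p n.+1 - mu0 p.1 p.2 / sigma0 p.1 p.2 ^+ 2) * noise p ^+ 2
  - (csum X truth p 1 (1 + n) w + n.+1%:R * truth p).
have mV : measurable_fun (setT : set (sigmaType X G J)) V.
  apply: measurable_funB => //; first apply: measurable_funM => //.
    by apply: measurable_funB => //; apply: measurable_funM.
  apply: measurable_funD => //; apply: adapted_csum => i; rewrite /J/= => i1 [i0].
  by rewrite i0 in i1.
have noise_gt0 q : 0 < noise q by exact: sigma_gt0.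
have law q j (B : set R) : measurable B ->
    distribution P (X (q, j)) B = normal_prob (truth q) (noise q) B.
  by case: q => i d'; exact: hXlaw.
have nJ : ~ J (p, 0%N) by apply.
have := adapted_neq_cent hG hGm hXG hXindep law nJ mV.
apply: negligibleS.
move=> w /= eqU; rewrite /V -eqU /pmean [pvar _ _ * _]mulrC mulfK ?gt_eqF ?pvar_gt0//.
rewrite [_ / _ + _]addrC addrK divfK ?expf_neq0 ?gt_eqF//.
have -> : csum X truth p 0 n.+1 w = cent X truth p 0 w + csum X truth p 1 (1 + n) w.
  by rewrite /csum big_nat_recl// add1n big_add1.
by ring.
Qed.

(** The separation of p and x equals that of y and z exactly when the mean of p is
one of the two roots of a quadratic equation, the sign being given by s. With
[y = z] this also forbids equal means. *)
Definition untied (w : T) : Prop :=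
  forall (p x y z : E) (n : nat) (ox oy oz : option nat) (s : bool),
  (0 < n)%N -> x != p -> y != p -> z != p ->
  pmean p n w <> limit_mean ox x w +
    (-1) ^+ s * Num.sqrt ((pvar p n + limit_var ox x) / (limit_var oy y + limit_var oz z))
    * (limit_mean oy y w - limit_mean oz z w).

(** Although the counts at which pairs stop are random, they range over a countable
set, so that it suffices to exclude each equation with deterministic counts. *)
Lemma ae_untied : {ae P, forall w, untied w}.
Proof.
pose I : Type :=
  (((E * E) * (E * E)) * ((nat * option nat) * (option nat * option nat)) * bool)%type.
pose F (i : I) : set T := let: ((p, x), (y, z), ((n, ox), (oy, oz)), s) := i in
  if [&& (0 < n)%N, x != p, y != p & z != p] then
  [set w | pmean p n w = limit_mean ox x w +
    (-1) ^+ s * Num.sqrt ((pvar p n + limit_var ox x) / (limit_var oy y + limit_var oz z))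
    * (limit_mean oy y w - limit_mean oz z w)] else set0.
apply: (@negligibleS _ _ _ P (\bigcup_i F i)).
  move=> w /= nu; apply: contrapT => nF; apply: nu => p x y z n ox oy oz s n0 xp yp zp eqn.
  apply: nF; exists ((p, x), (y, z), ((n, ox), (oy, oz)), s) => //=.
  by rewrite n0 xp yp zp.
apply: negligible_countable_bigcup => -[[[[p x] [y z]] [[n ox] [oy oz]]] s] /=.
case: ifP => [/and4P[n0 xp yp zp]|_]; last exact: negligible_set0.
apply: pmean_neq_adapted => //; apply: measurable_funD.
  by apply: limit_mean_adapted.
apply: measurable_funM => //; apply: measurable_funB; exact: limit_mean_adapted.
Qed.

End Ties.

(** * The argument along one path *)

(** What is used of a path: [c t p] counts the replications of p by time t, and
[Mn p n], [v p n] are the posterior mean and variance of p after n replications.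
The last hypothesis is the recurrence of pushes: at arbitrarily large scales N,
some pair q of S moves away in the prescribed direction, while the other pairs
of S stay closer to the truth by a margin of [K / sqrt N], for any given K. *)
Section Deterministic.
Context (R : realType) (k m : nat).
Local Notation E := ('I_k * 'I_m)%type.
Context (mu : E -> R) (Mn v : E -> nat -> R) (c : nat -> E -> nat) (A : nat -> E).
Context (D : nat -> 'I_k -> 'I_m) (b : nat -> 'I_k).
Context (worst : 'I_k -> 'I_m) (best : 'I_k) (t0 : nat) (Vm : R).

Definition separation (x y u w : R) : R := (x - y) ^+ 2 / (u + w).
Definition cur_mean t x := Mn x (c t x).
Definition cur_var t (r : option E) x := v x (c t x + (r == Some x)).
(** [Some p] grants one more replication to p before the next decision. *)
Definition edge_sep t r (e : E * E) :=
  separation (cur_mean t e.1) (cur_mean t e.2) (cur_var t r e.1) (cur_var t r e.2).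

(** As for [limit_mean], [Some n] stands for a pair frozen after n replications. *)
Let mean_at (o : option nat) p := if o is Some n then Mn p n else mu p.
Let var_at (o : option nat) p := if o is Some n then v p n else 0.

Hypothesis cS : forall t p, c t.+1 p = (c t p + (A t == p))%N.
Hypothesis c_pos : forall t p, (t0 <= t)%N -> (0 < c t p)%N.
Hypothesis v_gt0 : forall p n, 0 < v p n.
Hypothesis v_decr : forall p n, v p n.+1 < v p n.
Hypothesis v_le : forall p n, (0 < n)%N -> v p n <= Vm / n%:R.
Hypothesis Mn_cvg : forall p, Mn p n @[n --> \oo] --> mu p.
Hypothesis no_tie : forall (p x y z : E) (n : nat) (ox oy oz : option nat) (s : bool),
  (0 < n)%N -> x != p -> y != p -> z != p ->
  Mn p n <> mean_at ox x +
    (-1) ^+ s * Num.sqrt ((v p n + var_at ox x) / (var_at oy y + var_at oz z)) *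
    (mean_at oy y - mean_at oz z).
Hypothesis D_min : forall t i d, cur_mean t (i, D t i) <= cur_mean t (i, d).
Hypothesis b_max : forall t i, cur_mean t (i, D t i) <= cur_mean t (b t, D t (b t)).
Hypothesis choice_edge : forall t q e0, (t0 <= t)%N -> candidate (D t) (b t) q ->
  is_edge (D t) (b t) e0 -> exists2 e', is_edge (D t) (b t) e' &
    forall e, is_edge (D t) (b t) e -> edge_sep t (Some q) e' <= edge_sep t (Some (A t)) e.
Hypothesis cand_A : forall t, (t0 <= t)%N -> candidate (D t) (b t) (A t).
Hypothesis worst_le : forall i d, mu (i, worst i) <= mu (i, d).
Hypothesis best_gt : forall j, j != best -> mu (j, worst j) < mu (best, worst best).
Hypothesis pushes : forall (S : {set E}) (K : nat), (exists p, p \in S) ->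
  (forall p, p \in S -> forall M, exists t, (M <= c t p)%N) ->
  exists C : R, forall N0, exists N q t,
    [/\ (N0 <= N)%N, (0 < N)%N, q \in S, c t q = N &
     [/\ (forall p, p \in S -> p != q -> (N <= c t p)%N),
      (forall p n, p \in S -> p != q -> (N <= n)%N ->
         `|Mn p n - mu p| <= C / Num.sqrt N%:R) &
      (C + K%:R) / Num.sqrt N%:R <=
        (if q.1 == best then -1 else 1) * (Mn q (N + N) - mu q)]].

Lemma c_mono p t u : (t <= u)%N -> (c t p <= c u p)%N.
Proof.
move=> /subnKC <-; elim: (u - t)%N => [|n IH]; first by rewrite addn0.
by rewrite addnS cS (leq_trans IH)// leq_addr.
Qed.

Let Vm_gt0 : (0 < k)%N -> (0 < m)%N -> 0 < Vm.
Proof.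
move=> k0 m0; have := v_le (Ordinal k0, Ordinal m0) (ltnSn 0).
by rewrite divr1; apply: lt_le_trans.
Qed.

Lemma v_anti p n n' : (n <= n')%N -> v p n' <= v p n.
Proof.
move=> /subnKC <-; elim: (n' - n)%N => [|i IH]; first by rewrite addn0.
by rewrite addnS (le_trans (ltW (v_decr _ _))).
Qed.

Lemma v_cvg0 p : v p n @[n --> \oo] --> (0 : R).
Proof.
have k0 : (0 < k)%N by rewrite (leq_ltn_trans _ (ltn_ord p.1)).
have m0 : (0 < m)%N by rewrite (leq_ltn_trans _ (ltn_ord p.2)).
have V0 := Vm_gt0 k0 m0.
apply/cvgrPdist_le => e e0; near=> n.
have n0 : (0 < n)%N by near: n; exists 1%N.
rewrite sub0r normrN gtr0_norm// (le_trans (v_le p n0))//.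
rewrite ler_pdivrMr ?ltr0n// -ler_pdivrMl// mulrC.
near: n; exists (Num.truncn (Vm / e)).+1 => // n /= nle.
by apply: (le_trans (ltW (truncnS_gt _))); rewrite ler_nat.
Unshelve. all: by end_near.
Qed.

Let var_at_ge0 o p : 0 <= var_at o p. Proof. by case: o => //= n; exact: ltW. Qed.

Lemma no_tie_separation p x y z n ox oy oz : (0 < n)%N -> x != p -> y != p -> z != p ->
  0 < var_at oy y + var_at oz z ->
  separation (Mn p n) (mean_at ox x) (v p n) (var_at ox x) <>
  separation (mean_at oy y) (mean_at oz z) (var_at oy y) (var_at oz z).
Proof.
move=> n0 xp yp zp v2; rewrite /separation.
have := @no_tie p x y z n ox oy oz false n0 xp yp zp.
have := @no_tie p x y z n ox oy oz true n0 xp yp zp.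
set a := Mn p n; set w := mean_at oy y - _; set v1 := v p n + _; set u := var_at oy y + _ in v2 *.
rewrite expr0 expr1 mul1r mulN1r => nt1 nt2 eqn.
have v10 : 0 < v1 by rewrite /v1 ltr_pwDl.
have : (a - mean_at ox x) ^+ 2 = (Num.sqrt (v1 / u) * w) ^+ 2.
  rewrite exprMn sqr_sqrtr ?divr_ge0 ?ltW//.
  move/(congr1 (fun z => z * v1)) : eqn; rewrite divfK ?gt_eqF// => ->.
  by ring.
move/eqP; rewrite eqf_sqr => /orP[/eqP h|/eqP h].
  by apply: nt2; rewrite -h; ring.
by apply: nt1; rewrite mulNr -h; ring.
Qed.

Lemma no_tie_mean p x n ox : (0 < n)%N -> x != p -> Mn p n <> mean_at ox x.
Proof.
move=> n0 xp; have := @no_tie p x x x n ox ox ox false n0 xp xp xp.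
by rewrite subrr mulr0 addr0.
Qed.

Lemma limit_count p : exists o : option nat,
  if o is Some n then (0 < n)%N /\ \forall t \near \oo, c t p = n
  else forall N, \forall t \near \oo, (N <= c t p)%N.
Proof.
have [inf|fin] := pselect (forall N, exists t, (N <= c t p)%N).
  exists None => N; have [t Nt] := inf N.
  by exists t => // u /= tu; rewrite (leq_trans Nt)// c_mono.
have [N cN] : exists N, forall t, (c t p < N)%N.
  apply: contrapT => nN; apply: fin => N; apply: contrapT => nt; apply: nN.
  by exists N => t; rewrite ltnNge; apply/negP => h; apply: nt; exists t.
pose Q n := `[< exists t, c t p = n >].
have Q0 : exists n, Q n by exists (c 0 p); apply/asboolP; exists 0%N.
have Qb n : Q n -> (n <= N)%N by move=> /asboolP[t <-]; exact: ltnW.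
have := ex_maxnP Q0 Qb => -[n /asboolP[t ctn] nmax].
have cE u : (t <= u)%N -> c u p = n.
  move=> tu; apply/eqP; rewrite eqn_leq nmax; last by apply/asboolP; exists u.
  by rewrite -ctn c_mono.
exists (Some n); split; last by exists t.
by rewrite -(cE (maxn t t0)) ?leq_maxl// c_pos// leq_maxr.
Qed.

Lemma cvg_lt_near (f g : nat -> R) x y : f n @[n --> \oo] --> x ->
  g n @[n --> \oo] --> y -> x < y -> \forall n \near \oo, f n < g n.
Proof.
move=> fx gy xy; near=> n; apply: (@lt_trans _ _ ((x + y) / 2)).
  by near: n; apply: cvgr_lt fx _ _; rewrite midf_lt.
by near: n; apply: cvgr_gt gy _ _; rewrite midf_lt.
Unshelve. all: by end_near.
Qed.

Section Limits.
Variable o : E -> option nat.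
Hypothesis oP : forall p, if o p is Some n then (0 < n)%N /\ \forall t \near \oo, c t p = n
  else forall N, \forall t \near \oo, (N <= c t p)%N.

Let mean_lim p := mean_at (o p) p.
Let var_lim p (a : bool) := if o p is Some n then v p (n + a) else 0.
Let edge_sep_lim (r : option E) (e : E * E) :=
  separation (mean_lim e.1) (mean_lim e.2)
    (var_lim e.1 (r == Some e.1)) (var_lim e.2 (r == Some e.2)).
Let stopped p : bool := isSome (o p).
Let has_stopped (e : E * E) := stopped e.1 || stopped e.2.

Let var_lim_ge0 p a : 0 <= var_lim p a.
Proof. by rewrite /var_lim; case: (o p) => // n; exact: ltW. Qed.

Let var_lim_gt0 p a : stopped p -> 0 < var_lim p a.
Proof. by rewrite /stopped /var_lim; case: (o p). Qed.

Let var_lim_sum_gt0 e a a' : has_stopped e -> 0 < var_lim e.1 a + var_lim e.2 a'.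
Proof.
by case/orP => h; [rewrite ltr_pwDl// var_lim_gt0|rewrite ltr_wpDl// var_lim_gt0].
Qed.

Let count_cvg p : o p = None -> c t p @[t --> \oo] --> \oo.
Proof. by move=> op; apply/cvgnyPge => N; have := oP p; rewrite op; exact. Qed.

Lemma cur_mean_cvg p : cur_mean t p @[t --> \oo] --> mean_lim p.
Proof.
rewrite /cur_mean /mean_lim; case op : (o p) => [n|] /=.
  have := oP p; rewrite op => -[_ cn].
  by apply: cvg_near_cst; apply: filterS cn => t ->.
by apply: (@cvg_comp _ _ _ (fun t => c t p) (Mn p) _ _ _ (count_cvg op)); exact: Mn_cvg.
Qed.

Lemma cur_var_cvg r p : cur_var t r p @[t --> \oo] --> var_lim p (r == Some p).
Proof.
rewrite /cur_var /var_lim; case op : (o p) => [n|] /=.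
  have := oP p; rewrite op => -[_ cn].
  by apply: cvg_near_cst; apply: filterS cn => t ->.
have h : c t p + (r == Some p) @[t --> \oo] --> \oo.
  apply/cvgnyPge => N; have := oP p; rewrite op => /(_ N).
  by apply: filterS => t; lia.
by apply: (@cvg_comp _ _ _ _ (v p) _ _ _ h); exact: v_cvg0.
Qed.

Lemma edge_sep_cvg r e : has_stopped e -> edge_sep t r e @[t --> \oo] --> edge_sep_lim r e.
Proof.
move=> Fe; rewrite /edge_sep /edge_sep_lim /separation.
have h1 : cur_mean t e.1 - cur_mean t e.2 @[t --> \oo] --> mean_lim e.1 - mean_lim e.2.
  by apply: cvgB; exact: cur_mean_cvg.
have h2 : cur_var t r e.1 + cur_var t r e.2 @[t --> \oo] -->
    var_lim e.1 (r == Some e.1) + var_lim e.2 (r == Some e.2).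
  by apply: cvgD; exact: cur_var_cvg.
apply: cvgM.
  rewrite [X in _ --> X]expr2; under eq_fun do rewrite expr2.
  by apply: cvgM; exact: h1.
by apply: cvgV h2; rewrite gt_eqF// var_lim_sum_gt0.
Qed.

(** The squared difference has a positive limit and the variances vanish. *)
Lemma edge_sep_cvgy K e : ~~ stopped e.1 -> ~~ stopped e.2 -> mean_lim e.1 != mean_lim e.2 ->
  \forall t \near \oo, K < edge_sep t None e.
Proof.
move=> s1 s2 ne; set dd := (mean_lim e.1 - mean_lim e.2) ^+ 2.
have dd0 : 0 < dd by rewrite exprn_even_gt0//= subr_eq0.
have K1 : 0 < `|K| + 1 by rewrite ltr_wpDl.
have h1 : cur_mean t e.1 - cur_mean t e.2 @[t --> \oo] --> mean_lim e.1 - mean_lim e.2.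
  by apply: cvgB; exact: cur_mean_cvg.
have h2 : cur_var t None e.1 + cur_var t None e.2 @[t --> \oo] -->
    var_lim e.1 false + var_lim e.2 false.
  by apply: cvgD; exact: cur_var_cvg.
have h2' : (`|K| + 1) * (cur_var t None e.1 + cur_var t None e.2) @[t --> \oo] --> (0 : R).
  rewrite -(mulr0 (`|K| + 1)); apply: cvgMr; move: h2.
  move: s1 s2; rewrite /stopped /var_lim; case: (o e.1) => //; case: (o e.2) => //= _ _.
  by rewrite addr0.
have h1' : (cur_mean t e.1 - cur_mean t e.2) * (cur_mean t e.1 - cur_mean t e.2)
    @[t --> \oo] --> (mean_lim e.1 - mean_lim e.2) * (mean_lim e.1 - mean_lim e.2).
  by apply: cvgM; exact: h1.
have := cvg_lt_near h2' h1'; rewrite -expr2 => /(_ dd0); apply: filterS => t /= lt.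
rewrite /edge_sep /separation ltr_pdivlMr; last by rewrite addr_gt0 ?v_gt0.
rewrite expr2; apply: le_lt_trans lt.
rewrite ler_wpM2r//; first by rewrite ltW// addr_gt0 ?v_gt0.
by rewrite (le_trans (ler_norm _))// lerDl.
Qed.

Lemma edge_sep_lim_unstopped a e : ~~ stopped a -> edge_sep_lim (Some a) e = edge_sep_lim None e.
Proof.
move=> sa; rewrite /edge_sep_lim; congr separation.
  by rewrite /=; case: eqVneq => // -[aE]; move: sa; rewrite /stopped /var_lim aE; case: (o _).
by rewrite /=; case: eqVneq => // -[aE]; move: sa; rewrite /stopped /var_lim aE; case: (o _).
Qed.

(** Larger than the limit separation of every edge with a stopped end, the only
edges for which this limit is not degenerate. *)
Let sep_bound : R := 1 + \sum_(e : E * E) `|edge_sep_lim None e|.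

Let edge_sep_lim_lt e : edge_sep_lim None e < sep_bound.
Proof.
rewrite /sep_bound (bigD1 e)//= (le_lt_trans (ler_norm _))//.
by rewrite addrCA ltrDl ltr_pwDl// sumr_ge0.
Qed.

Let eventually_mean : \forall t \near \oo, forall p q : E,
  mean_lim p < mean_lim q -> cur_mean t p < cur_mean t q.
Proof.
apply: filter_forall => p; apply: filter_forall => q.
have [lt|_] := boolP (mean_lim p < mean_lim q); last exact: nearW.
by apply: filterS (cvg_lt_near (@cur_mean_cvg p) (@cur_mean_cvg q) lt).
Qed.

Let eventually_near : \forall t \near \oo, forall p : E, `|cur_mean t p| <= `|mean_lim p| + 1.
Proof.
apply: filter_forall => p; have /cvgrPdist_le/(_ 1 ltr01) := @cur_mean_cvg p.
apply: filterS => t h; rewrite -[cur_mean t p](subrK (mean_lim p)) addrC.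
by rewrite (le_trans (ler_normD _ _))// lerD2l distrC.
Qed.

Let eventually_stopped : \forall t \near \oo, forall p : E,
  stopped p -> cur_var t None p = var_lim p false /\ A t != p.
Proof.
apply: filter_forall => p; rewrite /stopped /var_lim /cur_var; have := oP p.
case: (o p) => [n [_ [T1 _ cn]]|_]; last exact: nearW.
exists T1 => // t /= T1t _; rewrite (cn _ T1t); split => //.
apply/eqP => At; have := cn t.+1 (leqW T1t).
by rewrite /= cS (cn _ T1t) At eqxx; lia.
Qed.

Let eventually_edge_sep : \forall t \near \oo, forall (a p : E) (e0 e : E * E),
  ~~ stopped a -> has_stopped e0 -> has_stopped e ->
        edge_sep_lim None e0 < edge_sep_lim (Some p) e ->
  edge_sep t (Some a) e0 < edge_sep t (Some p) e.
Proof.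
apply: filter_forall => a; apply: filter_forall => p.
apply: filter_forall => e0; apply: filter_forall => e.
have [/and4P[sa F0 F1 lt]|nh] := boolP [&& ~~ stopped a, has_stopped e0, has_stopped e &
    edge_sep_lim None e0 < edge_sep_lim (Some p) e]; last first.
  by apply: nearW => t sa F0 F1 lt; move: nh; rewrite sa F0 F1 lt.
have h : edge_sep t (Some a) e0 @[t --> \oo] --> edge_sep_lim None e0.
  by rewrite -(edge_sep_lim_unstopped e0 sa); exact: (@edge_sep_cvg _ _ F0).
by apply: filterS (cvg_lt_near h (@edge_sep_cvg (Some p) _ F1) lt).
Qed.

Let eventually_bounded : \forall t \near \oo, forall (a : E) (e : E * E),
  ~~ stopped a -> has_stopped e -> edge_sep t (Some a) e < sep_bound.
Proof.
apply: filter_forall => a; apply: filter_forall => e.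
have [sa|_] := boolP (~~ stopped a); last exact: nearW.
have [Fe|_] := boolP (has_stopped e); last exact: nearW.
have h := @edge_sep_cvg (Some a) _ Fe; rewrite (edge_sep_lim_unstopped e sa) in h.
by apply: filterS (cvgr_lt _ h _ (edge_sep_lim_lt e)).
Qed.

Let eventually_large : \forall t \near \oo, forall e : E * E,
  ~~ stopped e.1 -> ~~ stopped e.2 -> mean_lim e.1 != mean_lim e.2 -> sep_bound < edge_sep t None e.
Proof.
apply: filter_forall => e.
have [s1|_] := boolP (~~ stopped e.1); last exact: nearW.
have [s2|_] := boolP (~~ stopped e.2); last exact: nearW.
have [ne|_] := boolP (mean_lim e.1 != mean_lim e.2); last exact: nearW.
by apply: filterS (edge_sep_cvgy sep_bound s1 s2 ne).
Qed.

Let endpoint (p : E) (e : E * E) := (p == e.1) || (p == e.2).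

Lemma separationC x y u w : separation x y u w = separation y x w u.
Proof. by rewrite /separation -sqrrN opprB [u + w]addrC. Qed.

Lemma separation_le x y u w u' w' : 0 < u' + w' -> u' + w' <= u + w ->
  separation x y u w <= separation x y u' w'.
Proof.
move=> uw' le; rewrite /separation ler_wpM2l ?sqr_ge0// lef_pV2 ?posrE//.
exact: lt_le_trans le.
Qed.

Lemma separation_lt x y u w u' w' : x != y -> 0 < u' + w' -> u' + w' < u + w ->
  separation x y u w < separation x y u' w'.
Proof.
move=> xy uw' lt; rewrite /separation ltr_pM2l ?exprn_even_gt0 ?subr_eq0//=.
by rewrite ltf_pV2 ?posrE// (lt_trans uw').
Qed.

Lemma cur_var_gt0 t r p : 0 < cur_var t r p. Proof. exact: v_gt0. Qed.

Lemma cur_var_le t r p : cur_var t (Some r) p <= cur_var t None p.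
Proof. by apply: v_anti; rewrite addn0 leq_addr. Qed.

Lemma cur_var_lt t p : cur_var t (Some p) p < cur_var t None p.
Proof. by rewrite /cur_var eqxx addn1 addn0; exact: v_decr. Qed.

Lemma cur_var_neq t r p : r != p -> cur_var t (Some r) p = cur_var t None p.
Proof. by move=> rp; rewrite /cur_var (_ : (Some r == Some p) = false)//; exact/negbTE. Qed.

Lemma cur_mean_neq t p q : (t0 <= t)%N -> p != q -> cur_mean t p != cur_mean t q.
Proof.
move=> tt pq; apply/eqP; rewrite eq_sym in pq.
exact: (no_tie_mean (ox := Some (c t q)) (c_pos p tt) pq).
Qed.

Lemma edge_sep_le t r e : edge_sep t None e <= edge_sep t (Some r) e.
Proof. by apply: separation_le; rewrite ?addr_gt0 ?cur_var_gt0// lerD ?cur_var_le. Qed.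

Lemma edge_sep_off t r e : ~~ endpoint r e -> edge_sep t (Some r) e = edge_sep t None e.
Proof. by rewrite negb_or => /andP[r1 r2]; rewrite /edge_sep !cur_var_neq. Qed.

Lemma edge_sep_lt t r e : (t0 <= t)%N -> e.1 != e.2 -> endpoint r e ->
  edge_sep t None e < edge_sep t (Some r) e.
Proof.
move=> tt ne re; apply: separation_lt; rewrite ?addr_gt0 ?cur_var_gt0 ?cur_mean_neq//.
case/orP: re => /eqP ->.
  by apply: ltr_leD; [exact: cur_var_lt|exact: cur_var_le].
by apply: ler_ltD; [exact: cur_var_le|exact: cur_var_lt].
Qed.

Lemma edge_sep_neq t p e1 e2 : (t0 <= t)%N -> endpoint p e1 -> e1.1 != e1.2 -> ~~ endpoint p e2 ->
  edge_sep t None e1 <> edge_sep t None e2.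
Proof.
move=> tt p1 ne; rewrite negb_or => /andP[p21 p22].
have key x : x != p -> 
    separation (cur_mean t p) (cur_mean t x) (cur_var t None p) (cur_var t None x) <> edge_sep t None e2.
  move=> xp; rewrite /edge_sep /cur_var /= !addn0.
  apply: (@no_tie_separation p x e2.1 e2.2 (c t p) (Some _) (Some _) (Some _)) => //=.
  - exact: c_pos.
  - by rewrite eq_sym.
  - by rewrite eq_sym.
  - by rewrite addr_gt0.
case/orP: p1 => /eqP pE; last first.
  by rewrite /edge_sep separationC -pE; apply: key; rewrite pE.
by rewrite {1}/edge_sep -pE; apply: key; rewrite pE eq_sym.
Qed.

Let var_lim_false x : var_lim x false = var_at (o x) x.
Proof. by rewrite /var_lim /var_at; case: (o x) => // n; rewrite addn0. Qed.

Lemma edge_sep_lim_neq p e1 e2 : stopped p -> endpoint p e1 -> e1.1 != e1.2 -> ~~ endpoint p e2 ->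
  has_stopped e2 -> edge_sep_lim None e1 <> edge_sep_lim None e2.
Proof.
move=> sp p1 ne; rewrite negb_or => /andP[p21 p22] F2.
have key x : x != p ->
    separation (mean_lim p) (mean_lim x) (var_lim p false) (var_lim x false) <> edge_sep_lim None e2.
  move=> xp; rewrite /edge_sep_lim /= !var_lim_false /mean_lim.
  move: sp (oP p); rewrite /stopped; case: (o p) => // n _ [n0 _].
  apply: no_tie_separation => //; try by rewrite eq_sym.
  by have := var_lim_sum_gt0 false false F2; rewrite !var_lim_false.
case/orP: p1 => /eqP pE; last first.
  by rewrite {1}/edge_sep_lim separationC -pE; apply: key; rewrite pE.
by rewrite {1}/edge_sep_lim -pE; apply: key; rewrite pE eq_sym.
Qed.

Lemma mean_lim_neq p q : stopped p -> q != p -> mean_lim p != mean_lim q.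
Proof.
rewrite /mean_lim /stopped; have := oP p; case: (o p) => // n [n0 _] _ qp.
by apply/eqP; exact: no_tie_mean.
Qed.

Let var_lim_anti x a : var_lim x true <= var_lim x a.
Proof. by rewrite /var_lim; case: (o x) => // n; apply: v_anti; case: a; lia. Qed.

Let var_lim_lt x : stopped x -> var_lim x true < var_lim x false.
Proof. by rewrite /var_lim /stopped; case: (o x) => // n _; rewrite addn0 addn1. Qed.

Lemma edge_sep_lim_lt_some p e : stopped p -> endpoint p e -> e.1 != e.2 ->
  edge_sep_lim None e < edge_sep_lim (Some p) e.
Proof.
move=> sp pe ne; have mne : mean_lim e.1 != mean_lim e.2.
  case/orP: pe => /eqP pE; first by rewrite -pE mean_lim_neq// pE eq_sym.
  by rewrite eq_sym -pE mean_lim_neq// pE.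
have Fe : has_stopped e by case/orP: pe => /eqP pE; rewrite /has_stopped -pE sp ?orbT.
apply: separation_lt => //; first exact: var_lim_sum_gt0.
case/orP: pe => /eqP pE.
  rewrite -pE eqxx; apply: ltr_leD; first exact: var_lim_lt.
  by case: (_ == _) => //; exact: var_lim_anti.
rewrite -pE eqxx; apply: ler_ltD; last exact: var_lim_lt.
by case: (_ == _) => //; exact: var_lim_anti.
Qed.

Let edge t e := is_edge (D t) (b t) e.

Lemma edge_neq t e : edge t e -> e.1 != e.2.
Proof.
move=> /and3P[/eqP e1 e2 _]; apply/eqP => ee.
by rewrite -ee e1 eqxx in e2.
Qed.

Lemma endpoint_candidate t e p : edge t e -> endpoint p e -> candidate (D t) (b t) p.
Proof.
move=> /and3P[/eqP e1 e2 e3] /orP[/eqP ->|/eqP ->]; rewrite /candidate ?e1 ?eqxx//.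
by rewrite e3 orbT.
Qed.

(** All the asymptotic information, gathered so that one late time can be analysed
by exact comparisons. *)
Let good t : Prop := [/\ (t0 <= t)%N,
  forall p q : E, mean_lim p < mean_lim q -> cur_mean t p < cur_mean t q,
  forall p : E, `|cur_mean t p| <= `|mean_lim p| + 1,
  forall p : E, stopped p -> cur_var t None p = var_lim p false /\ A t != p &
  [/\ forall (a p : E) (e0 e : E * E),
        ~~ stopped a -> has_stopped e0 -> has_stopped e ->
        edge_sep_lim None e0 < edge_sep_lim (Some p) e ->
        edge_sep t (Some a) e0 < edge_sep t (Some p) e,
      forall (a : E) (e : E * E), ~~ stopped a -> has_stopped e ->
        edge_sep t (Some a) e < sep_bound &
      forall e : E * E, ~~ stopped e.1 -> ~~ stopped e.2 -> mean_lim e.1 != mean_lim e.2 ->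
        sep_bound < edge_sep t None e]].

Let eventually_good : \forall t \near \oo, good t.
Proof.
have ht : \forall t \near \oo, (t0 <= t)%N by exists t0.
near=> t; split; last split.
- by near: t.
- by near: t; exact: eventually_mean.
- by near: t; exact: eventually_near.
- by near: t; exact: eventually_stopped.
- by near: t; exact: eventually_edge_sep.
- by near: t; exact: eventually_bounded.
- by near: t; exact: eventually_large.
Unshelve. all: by end_near.
Qed.

(** Let e1 have the least limit separation among the edges with a stopped end, and
let p be such an end. Granted one more replication of p, every edge with a
stopped end exceeds the limit of e1 strictly: those at p because p is improved,
the others because there are no ties. The choice made instead of p concerns an
unstopped pair, which leaves e1 at its limit. Hence the minimum for p is attained
at an edge with unstopped ends only, and it is bounded by about the limit
separation of e1. *)
Lemma key_edge t e0 : good t -> edge t e0 -> has_stopped e0 ->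
  exists e', [/\ edge t e', ~~ stopped e'.1, ~~ stopped e'.2,
    forall e, edge t e -> edge_sep t None e' <= edge_sep t (Some (A t)) e &
    edge_sep t None e' < sep_bound].
Proof.
move=> [tt _ _ gS [gT gB _]] ed0 F0.
have sA : ~~ stopped (A t) by apply/negP => /gS[_]; rewrite eqxx.
have P0 : edge t e0 && has_stopped e0 by rewrite ed0.
have [e1 /andP[ed1 F1] e1min] := @Order.TotalTheory.arg_minP _ _ _ e0
  (fun e => edge t e && has_stopped e) (edge_sep_lim None) P0.
have [p sp pe1] : exists2 p, stopped p & endpoint p e1.
  by case/orP: F1 => h; [exists e1.1|exists e1.2] => //; rewrite /endpoint eqxx ?orbT.
have [e' ed' He'] := choice_edge tt (endpoint_candidate ed1 pe1) ed1.
have NF : ~~ has_stopped e'.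
  apply/negP => F'; have := He' _ ed1; rewrite leNgt => /negP; apply.
  apply: gT => //; have e1e' : edge_sep_lim None e1 <= edge_sep_lim None e'.
    by apply: e1min; apply/andP; split.
  have [pe'|pe'] := boolP (endpoint p e').
    by apply: (le_lt_trans e1e'); apply: edge_sep_lim_lt_some => //; exact: edge_neq ed'.
  have -> : edge_sep_lim (Some p) e' = edge_sep_lim None e'.
    move: pe'; rewrite negb_or => /andP[p1 p2]; rewrite /edge_sep_lim.
    by congr separation; congr var_lim; exact/negbTE.
  rewrite lt_neqAle e1e' andbT; apply/eqP.
  by apply: (@edge_sep_lim_neq p) => //; exact: edge_neq ed1.
move: (NF); rewrite negb_or => /andP[s1 s2].
have pe' : ~~ endpoint p e'.
  by apply/negP => /orP[/eqP pE|/eqP pE]; move: s1 s2; rewrite -pE sp.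
have He e : edge t e -> edge_sep t None e' <= edge_sep t (Some (A t)) e.
  by move=> ed; rewrite -(edge_sep_off t pe'); exact: He'.
exists e'; split => //.
by apply: le_lt_trans (He _ ed1) _; exact: gB.
Qed.

Let lowest i := [arg min_(d < worst i) mean_lim (i, d)]%O.
Let low_mean i := mean_lim (i, lowest i).
Let low_mean_le i d : low_mean i <= mean_lim (i, d).
Proof.
rewrite /low_mean /lowest.
case: (Order.TotalTheory.arg_minP (fun d => mean_lim (i, d)) (isT : xpredT (worst i))).
by move=> d' _; exact.
Qed.

Let bb := [arg max_(i > best) low_mean i]%O.
(** The limit of the posterior worst mean of the posterior best alternative. *)
Let beta := low_mean bb.
Let low_mean_beta i : low_mean i <= beta.
Proof.
rewrite /beta /bb; case: (Order.TotalTheory.arg_maxP low_mean (isT : xpredT best)).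
by move=> j _; exact.
Qed.

Lemma good_worst t i : good t -> mean_lim (i, D t i) = low_mean i.
Proof.
move=> [_ gM _ _ _]; apply/eqP; rewrite eq_le low_mean_le andbT leNgt.
by apply/negP => /gM; rewrite ltNge D_min.
Qed.

Lemma good_best t : good t -> low_mean (b t) = beta.
Proof.
move=> gt; have [_ gM _ _ _] := gt; apply/eqP; rewrite eq_le low_mean_beta leNgt /=.
rewrite -(good_worst (b t) gt) /beta -(good_worst bb gt).
by apply/negP => /gM; rewrite ltNge b_max.
Qed.

(** If no edge between the alternative b and the true best one has a stopped end,
then every scenario of b and the posterior worst scenario of the true best
alternative have their true mean as limit. This contradicts that b looks
better. *)
Lemma stopped_edge t : good t -> b t != best -> exists2 e, edge t e & has_stopped e.
Proof.
move=> gt bn; have bb' : best != b t by rewrite eq_sym.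
pose e l : E * E := ((b t, l), (best, D t best)).
have ed l : edge t (e l) by rewrite /edge/is_edge/= !eqxx bb'.
have [|nF] := pselect (exists l, has_stopped (e l)); first by move=> [l Fl]; exists (e l).
have unst l : o (b t, l) = None /\ o (best, D t best) = None.
  have : ~~ has_stopped (e l) by apply/negP => h; apply: nF; exists l.
  by rewrite /has_stopped /stopped /e/= negb_or; case: (o (b t, l)); case: (o (best, _)).
have h1 : low_mean (b t) <= mu (b t, worst (b t)).
  by have := low_mean_le (b t) (worst (b t)); rewrite /mean_lim (unst _).1.
have h2 : mu (best, worst best) <= low_mean best.
  by rewrite -(good_worst best gt) /mean_lim (unst (worst best)).2 /=; exact: worst_le.
have := low_mean_beta best; rewrite -(good_best gt) leNgt => /negP; case.
by apply: le_lt_trans h1 _; apply: lt_le_trans h2; exact: best_gt.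
Qed.

Let tied : {set E} := [set p : E | (low_mean p.1 == beta) && (mean_lim p == beta)]%SET.

Let in_tied p : (p \in tied) = (low_mean p.1 == beta) && (mean_lim p == beta).
Proof. by rewrite inE. Qed.

(** A bounded separation with vanishing variances forces equal limit means; the
first is at least [beta] and the second at most [beta]. *)
Lemma small_edge_tied t e : good t -> edge t e -> ~~ stopped e.1 -> ~~ stopped e.2 ->
  edge_sep t None e < sep_bound -> e.1 \in tied /\ e.2 \in tied.
Proof.
move=> gt ed s1 s2 small; have [_ _ _ _ [_ _ gL]] := gt.
have eml : mean_lim e.1 = mean_lim e.2.
  apply/eqP; apply: contraTT small => ne; rewrite -leNgt; exact/ltW/gL.
have /and3P[/eqP e11 e21 /eqP e22] := ed.
have Wb := good_best gt.
have h1 : beta <= mean_lim e.1 by rewrite -Wb -e11; case: (e.1) => i d; exact: low_mean_le.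
have h2 : mean_lim e.2 = low_mean e.2.1.
  by rewrite -(good_worst e.2.1 gt) -e22; case: (e.2).
have h3 := low_mean_beta e.2.1.
have E2 : mean_lim e.2 = beta by apply/eqP; rewrite eq_le {1}h2 h3 -eml h1.
by rewrite !in_tied eml E2 -h2 E2 e11 Wb !eqxx.
Qed.

(** [key_edge] exhibits an unstopped tied pair, and the limit mean of a stopped pair
differs from that of any other pair. *)
Lemma tied_unstopped t p : good t -> b t != best -> p \in tied -> ~~ stopped p.
Proof.
move=> gt bn; have [e ed Fe] := stopped_edge gt bn.
have [e' [ed' s1 s2 _ small]] := key_edge gt ed Fe.
have [T1 _] := small_edge_tied gt ed' s1 s2 small.
rewrite in_tied => /andP[_ /eqP pb]; apply/negP => sp.
move: T1; rewrite in_tied => /andP[_ /eqP eb].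
have : e'.1 != p by apply/eqP => ep; move: s1; rewrite ep sp.
by move=> /(mean_lim_neq sp); rewrite pb eb eqxx.
Qed.

(** Replacing an end q by a closer one r shortens the difference of means from
[y + g] to [y]. This lowers the separation from the other end, of variance S,
whatever the variance of r, provided that the variance of q is small. *)
Lemma dominated (y g Sq Sr S : R) : 0 <= y -> 0 < g -> 0 < Sq -> 0 < Sr -> 0 < S ->
  y * Sq <= 2 * g * S -> y ^+ 2 / (Sr + S) < (y + g) ^+ 2 / (Sq + S).
Proof.
move=> y0 g0 q0 r0 S0 H.
rewrite ltr_pdivrMr ?addr_gt0// mulrAC ltr_pdivlMr ?addr_gt0//.
have h1 : y ^+ 2 * Sq <= y * (2 * g * S) by rewrite expr2 -mulrA ler_wpM2l.
have h2 : 0 < g ^+ 2 * S by rewrite mulr_gt0 ?exprn_gt0.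
have h3 : 0 <= (y + g) ^+ 2 * Sr by rewrite mulr_ge0 ?sqr_ge0// ltW.
have -> : (y + g) ^+ 2 * (Sr + S) =
  (y + g) ^+ 2 * Sr + (y ^+ 2 * S + y * (2 * g * S) + g ^+ 2 * S) by ring.
have -> : y ^+ 2 * (Sq + S) = y ^+ 2 * Sq + y ^+ 2 * S by ring.
by lra.
Qed.

Let mean_bound : R := \sum_(p : E) (`|mean_lim p| + 1).

Let mean_le_bound t p : good t -> `|cur_mean t p| <= mean_bound.
Proof.
move=> [_ _ gN _ _]; apply: (le_trans (gN p)).
by rewrite /mean_bound (bigD1 p)//= lerDl sumr_ge0.
Qed.

Let dir (q : E) : R := if q.1 == best then -1 else 1.

(** The situation at any later time at which the pushed pair q still has 2 N
replications. The last hypotheses ask that the margin K be large against the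
bounded separations, and that N be large for the variance of q to be negligible
against those of the stopped pairs. *)
Section Pushed.
Variables (t N K : nat) (q : E) (C : R).
Hypotheses (gt : good t) (N0 : (0 < N)%N) (K_gt0 : (0 < K)%N).
Hypotheses (qT : q \in tied) (cq : c t q = (N + N)%N).
Hypothesis c_ge : forall p, p \in tied -> p != q -> (N <= c t p)%N.
Hypothesis Tun : forall p, p \in tied -> ~~ stopped p.
Hypothesis others : forall p, p \in tied -> p != q ->
  `|cur_mean t p - mu p| <= C / Num.sqrt N%:R.
Hypothesis pushed : (C + K%:R) / Num.sqrt N%:R <= dir q * (cur_mean t q - mu q).
Hypothesis rival : exists2 j, j != best & low_mean j = beta.
Hypothesis K_large : sep_bound * (2 * Vm) <= K%:R ^+ 2.
Hypothesis N_large : forall x, stopped x ->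
  (2 * mean_bound) * Vm <= Num.sqrt N%:R * (2 * K%:R * var_lim x false).

Let g0 : R := K%:R / Num.sqrt N%:R.

Let sqrtN_gt0 : 0 < Num.sqrt N%:R :> R. Proof. by rewrite sqrtr_gt0 ltr0n. Qed.

Let g0_gt0 : 0 < g0. Proof. by rewrite divr_gt0// ltr0n. Qed.

Let tied_mu p : p \in tied -> mu p = beta.
Proof.
move=> pT; have := Tun pT; move: pT; rewrite in_tied => /andP[_ /eqP <-].
by rewrite /stopped /mean_lim; case: (o p).
Qed.

Let separated p : p \in tied -> p != q ->
  g0 <= dir q * (cur_mean t q - cur_mean t p).
Proof.
move=> pT pq; have := others pT pq; have := pushed.
rewrite !tied_mu// mulrDl -/g0 ler_norml; set r := C / _ => h1 /andP[h2 h3].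
by move: h1; rewrite /dir; case: ifP => _; lra.
Qed.

Let Vm0 : 0 < Vm.
Proof.
by apply: Vm_gt0; [exact: leq_ltn_trans (ltn_ord q.1)|exact: leq_ltn_trans (ltn_ord q.2)].
Qed.

Let var_q : cur_var t None q <= Vm / N%:R.
Proof.
apply: le_trans (v_le q N0); rewrite /cur_var addn0 cq.
by apply: v_anti; rewrite leq_addr.
Qed.

(** The variances are of order 1 / N, so a distance of [K / sqrt N] is a large
separation. *)
Let far p : p \in tied -> p != q ->
  sep_bound <= separation (cur_mean t q) (cur_mean t p) (cur_var t None q) (cur_var t None p).
Proof.
move=> pT pq; rewrite /separation ler_pdivlMr ?addr_gt0 ?cur_var_gt0//.
have NR : 0 < N%:R :> R by rewrite ltr0n.
have hp : cur_var t None p <= Vm / N%:R.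
  apply: le_trans (v_le p N0); rewrite /cur_var addn0.
  by apply: v_anti; exact: c_ge.
have sep_bound_ge0 : 0 <= sep_bound by rewrite addr_ge0 ?sumr_ge0.
apply: (@le_trans _ _ (sep_bound * (Vm / N%:R + Vm / N%:R))).
  by rewrite ler_wpM2l// lerD.
have -> : sep_bound * (Vm / N%:R + Vm / N%:R) = (sep_bound * (2 * Vm)) / N%:R by ring.
apply: (@le_trans _ _ (g0 ^+ 2)).
  by rewrite /g0 exprMn exprVn sqr_sqrtr ?ler0n// ler_wpM2r// invr_ge0 ltW.
have -> : (cur_mean t q - cur_mean t p) ^+ 2 =
    (dir q * (cur_mean t q - cur_mean t p)) ^+ 2.
  by rewrite exprMn /dir; case: ifP; rewrite ?sqrrN expr1n mul1r.
by rewrite ler_sqr ?nnegrE ?(ltW g0_gt0)// ?separated// (le_trans _ (separated pT pq))// ltW.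
Qed.

Let argmin_tied i : low_mean i = beta -> (i, D t i) \in tied.
Proof. by move=> Wi; rewrite in_tied /= (good_worst i gt) Wi eqxx. Qed.

(** If q belongs to the true best alternative, it has been pushed below all the
tied pairs of its rivals, so that its alternative is not the posterior best. If
q belongs to another alternative, it has been pushed above the tied pairs: it is
the posterior worst scenario of its alternative only if that is the posterior
best one. *)
Lemma pushed_best : A t = q -> b t != best /\ (q.1 == best \/ b t = q.1).
Proof.
move=> Aq; have tt : (t0 <= t)%N by case: gt.
have [qb|qb] := eqVneq q.1 best.
  split; last by left.
  apply/eqP => bt; have [j jb Wj] := rival.
  have jq : (j, D t j) != q by apply/eqP => jq; move: jb; rewrite -qb -jq eqxx.
  have := separated (argmin_tied Wj) jq.
  rewrite /dir qb eqxx => h.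
  have h2 := b_max t j; have h3 := D_min t best q.2.
  have qE : (best, q.2) = q by rewrite -qb; case: (q).
  rewrite qE bt in h2 h3; have := g0_gt0; lra.
suff bq : b t = q.1 by rewrite bq qb; split => //; right.
apply/eqP; apply: contraT => bq.
have := cand_A tt; rewrite Aq /candidate (eq_sym _ (b t)) (negbTE bq)/= => /eqP qD.
have qE : (q.1, D t q.1) = q by rewrite -qD; case: (q).
have bT : (b t, D t (b t)) \in tied by apply: argmin_tied; exact: good_best.
have bq' : (b t, D t (b t)) != q by apply/eqP => h; move: bq; rewrite -h eqxx.
have := separated bT bq'; rewrite /dir (negbTE qb).
have h2 := b_max t q.1; rewrite qE in h2; have := g0_gt0; lra.
Qed.

(** Suppose that q is sampled. The bounded edge e' of [key_edge] has tied ends, so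
it avoids q, which is far from all tied pairs. Compare with the candidate
[r = e'.1], which also improves e': the minimum for r is attained at an edge e''
that must end at q, for otherwise sampling r would be strictly better, as there
are no ties. The other end of e'' is not tied, hence stopped. But then the edge
from that stopped pair to the end of e' on the same side as q has a smaller
separation than e'', and it does not benefit from sampling q. *)
Lemma pushed_not_sampled : A t != q.
Proof.
apply/eqP => Aq; have [bn qcase] := pushed_best Aq.
have tt : (t0 <= t)%N by case: gt.
have [e0 ed0 F0] := stopped_edge gt bn.
have [e' [ed' s1 s2 He' small]] := key_edge gt ed0 F0.
rewrite Aq in He'.
have [T1 T2] := small_edge_tied gt ed' s1 s2 small.
have ne' := edge_neq ed'.
have q1 : e'.1 != q.
  apply/eqP => e1; have e2q : e'.2 != q by rewrite -e1 eq_sym.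
  by move: small; rewrite /edge_sep e1 ltNge far.
have q2 : e'.2 != q.
  apply/eqP => e2; have e1q : e'.1 != q by [].
  by move: small; rewrite /edge_sep separationC e2 ltNge far.
have offq : ~~ endpoint q e' by rewrite /endpoint !(eq_sym q) (negbTE q1) (negbTE q2).
have r_on : endpoint e'.1 e' by rewrite /endpoint eqxx.
have [e'' ed'' He''] := choice_edge tt (endpoint_candidate ed' r_on) ed'.
rewrite Aq in He''.
have le1 : edge_sep t (Some e'.1) e'' <= edge_sep t None e'.
  by rewrite -(edge_sep_off t offq); exact: He''.
have le2 : edge_sep t None e'' <= edge_sep t None e'.
  exact: le_trans (edge_sep_le t e'.1 e'') le1.
have ne'' := edge_neq ed''.
have [onq|offq''] := boolP (endpoint q e''); last first.
  have le3 : edge_sep t None e' <= edge_sep t None e''.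
    by rewrite -(edge_sep_off t offq''); exact: He'.
  have [r_on''|r_off''] := boolP (endpoint e'.1 e'').
    have := lt_le_trans (edge_sep_lt tt ne'' r_on'') le1.
    by rewrite ltNge le3.
  apply: (edge_sep_neq tt r_on ne' r_off''); apply/eqP; by rewrite eq_le le3 le2.
have /and3P[/eqP f11 f21 /eqP f22] := ed''.
have /and3P[/eqP e11 e21 /eqP e22] := ed'.
have small'' : edge_sep t None e'' < sep_bound by apply: le_lt_trans le2 small.
have un_q := Tun qT.
(* The other endpoint of the edge through q is a stopped pair. *)
have stop_other : has_stopped e''.
  apply: contraT; rewrite /has_stopped negb_or => /andP[u1 u2].
  have [U1 U2] := small_edge_tied gt ed'' u1 u2 small''.
  move: small''; rewrite /edge_sep; case/orP: onq => /eqP qe.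
    have x2 : e''.2 != q by rewrite qe eq_sym.
    by rewrite -qe ltNge far.
  have x1 : e''.1 != q by rewrite qe.
  by rewrite separationC -qe ltNge far.
have dom (x r : E) (y g : R) : stopped x -> 0 <= y -> y <= 2 * mean_bound -> g0 <= g ->
    y ^+ 2 / (cur_var t None r + cur_var t None x) <
    (y + g) ^+ 2 / (cur_var t None q + cur_var t None x).
  move=> sx y0 yY gg; have [_ _ _ gS _] := gt.
  apply: dominated; rewrite ?cur_var_gt0// ?(lt_le_trans g0_gt0)//.
  rewrite (gS x sx).1; have vx := var_lim_gt0 false sx.
  apply: (@le_trans _ _ (2 * mean_bound * (Vm / N%:R))).
    by apply: ler_pM => //; exact: ltW (cur_var_gt0 _ _ _).
  apply: (@le_trans _ _ (2 * g0 * var_lim x false)); last first.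
    by rewrite ler_wpM2r ?(ltW vx)// ler_wpM2l.
  rewrite mulrA ler_pdivrMr ?ltr0n//; apply: (le_trans (N_large sx)).
  rewrite /g0 -[X in _ <= _ * X]sqr_sqrtr ?ler0n// le_eqVlt; apply/orP; left; apply/eqP.
  by field; rewrite gt_eqF.
have bound x z : cur_mean t x - cur_mean t z <= 2 * mean_bound.
  have := mean_le_bound x gt; have := mean_le_bound z gt.
  by rewrite !ler_norml => /andP[? ?] /andP[? ?]; lra.
(* Replacing q by the endpoint of e' on the same side gives a smaller edge. *)
suff [f edf [offf ltf]] : exists2 f, edge t f &
    ~~ endpoint q f /\ edge_sep t None f < edge_sep t None e''.
  have := He' _ edf; rewrite (edge_sep_off t offf) leNgt => /negP; apply.
  exact: lt_le_trans le2.
have sep1 := separated T1 q1; have sep2 := separated T2 q2.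
case/orP: onq => /eqP qe.
- have sx : stopped e''.2 by move: stop_other; rewrite /has_stopped -qe (negbTE un_q).
  have dirq : dir q = 1.
    by rewrite /dir qe f11 (negbTE bn).
  rewrite dirq mul1r in sep1.
  exists (e'.1, e''.2); first by rewrite /edge /is_edge /= e11 eqxx f21 f22 eqxx.
  split.
    rewrite /endpoint /= negb_or !(eq_sym q) q1 /=; apply/eqP => x2.
    by rewrite -x2 sx in un_q.
  pose y := cur_mean t e'.1 - cur_mean t e''.2.
  pose g := cur_mean t q - cur_mean t e'.1.
  have y0 : 0 <= y.
    rewrite subr_ge0; have h1 := b_max t e''.2.1.
    have h2 := D_min t (b t) e'.1.2.
    have xE : (e''.2.1, D t e''.2.1) = e''.2 by rewrite -f22; case: (e''.2).
    have rE : (b t, e'.1.2) = e'.1 by rewrite -e11; case: (e'.1).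
    by rewrite xE in h1; rewrite rE in h2; exact: le_trans h1 h2.
  have := dom e''.2 e'.1 y g sx y0 (bound _ _) sep1.
  have -> : y + g = cur_mean t q - cur_mean t e''.2 by rewrite /y /g; ring.
  by rewrite /edge_sep /separation -qe.
- have sx : stopped e''.1 by move: stop_other; rewrite /has_stopped -qe (negbTE un_q) orbF.
  have qb : q.1 = best.
    case: qcase => [/eqP//|bq]; move: f21; rewrite -qe -bq eqxx //.
  have dirq : dir q = -1 by rewrite /dir qb eqxx.
  rewrite dirq mulN1r opprB in sep2.
  exists (e''.1, e'.2); first by rewrite /edge /is_edge /= f11 eqxx e21 e22 eqxx.
  split.
    rewrite /endpoint /= negb_or !(eq_sym q) q2 andbT; apply/eqP => x1.
    by rewrite -x1 sx in un_q.
  pose y := cur_mean t e''.1 - cur_mean t e'.2.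
  pose g := cur_mean t e'.2 - cur_mean t q.
  have y0 : 0 <= y.
    rewrite subr_ge0; have h1 := b_max t e'.2.1.
    have h2 := D_min t (b t) e''.1.2.
    have xE : (e'.2.1, D t e'.2.1) = e'.2 by rewrite -e22; case: (e'.2).
    have rE : (b t, e''.1.2) = e''.1 by rewrite -f11; case: (e''.1).
    by rewrite xE in h1; rewrite rE in h2; exact: le_trans h1 h2.
  have := dom e''.1 e'.2 y g sx y0 (bound _ _) sep2.
  have -> : y + g = cur_mean t e''.1 - cur_mean t q by rewrite /y /g; ring.
  by rewrite /edge_sep /separation -qe /= [cur_var t None e''.1 + _]addrC [X in _ -> _ < _ / X]addrC.
Qed.

End Pushed.

(** Otherwise there are tied pairs, all of them unstopped, to which the recurrence
of pushes applies. The pushed pair gets no replication beyond the 2 N-th, so it is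
stopped. *)
Lemma eventually_best : \forall t \near \oo, b t = best.
Proof.
have [T1 _ good1] := eventually_good.
apply: contrapT => nbest.
have often N : exists t, [/\ (N <= t)%N, good t & b t != best].
  apply: contrapT => nex; apply: nbest; exists (maxn N T1) => // t /= Nt.
  apply/eqP; apply: contraT => bn; case: nex; exists t; split => //.
    by rewrite (leq_trans _ Nt)// leq_maxl.
  by apply: good1; rewrite /= (leq_trans _ Nt)// leq_maxr.
have [t [_ gt bn]] := often 0%N.
have Tun p : p \in tied -> ~~ stopped p := @tied_unstopped t p gt bn.
have [e ed Fe] := stopped_edge gt bn.
have [e' [ed' s1 s2 _ small]] := key_edge gt ed Fe.
have [eT1 eT2] := small_edge_tied gt ed' s1 s2 small.
have rival : exists2 j, j != best & low_mean j = beta.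
  by exists (b t) => //; exact: good_best.
have inf p : p \in tied -> forall M, exists t, (M <= c t p)%N.
  move=> /Tun; rewrite /stopped; have := oP p; case: (o p) => // h _ M.
  by have [t' _ /(_ t' (leqnn _))] := h M; exists t'.
have k0 : (0 < k)%N by exact: leq_ltn_trans (ltn_ord best).
have m0 : (0 < m)%N by exact: leq_ltn_trans (ltn_ord (worst best)).
have V0 := Vm_gt0 k0 m0.
pose K := (Num.truncn (sep_bound * (2 * Vm))).+1.
have K_large : sep_bound * (2 * Vm) <= K%:R ^+ 2.
  apply: (@le_trans _ _ K%:R); first exact/ltW/truncnS_gt.
  by rewrite -natrX ler_nat; rewrite /K expnS expn1 leq_pmulr.
have exT : exists p, p \in tied by exists e'.1.
have [C HC] := pushes K exT inf.
have [N1 _ HN1] : \forall N \near \oo, forall x, stopped x ->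
    (2 * mean_bound) * Vm <= Num.sqrt N%:R * (2 * K%:R * var_lim x false).
  apply: filter_forall => x; have [sx|_] := boolP (stopped x); last exact: nearW.
  have vx : 0 < 2 * K%:R * var_lim x false by rewrite mulr_gt0 ?var_lim_gt0// mulr_gt0// ltr0n.
  pose z := (2 * mean_bound * Vm) / (2 * K%:R * var_lim x false).
  exists (Num.truncn (z ^+ 2)).+1 => // N /= zN _.
  rewrite -ler_pdivrMr// -/z (le_trans (ler_norm z))// -sqrtr_sqr ler_wsqrtr//.
  by apply: (le_trans (ltW (truncnS_gt _))); rewrite ler_nat.
pose N0 := maxn N1 (\max_(p : E) (c T1 p).+1)%N.
have [N [q [u [NN N_gt0 qT cu [cge quiet pushed]]]]] := HC N0.
have T1u : (T1 <= u)%N.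
  rewrite leqNgt; apply/negP => uT; have := c_mono q (ltnW uT).
  have : ((c T1 q).+1 <= N)%N.
    apply: leq_trans NN; apply: leq_trans (leq_maxr _ _).
    exact: (leq_bigmax (F := fun p => (c T1 p).+1)).
  by rewrite cu => h1 h2; have := leq_trans h1 h2; rewrite ltnn.
have bounded x : (c (u + x) q <= N + N)%N.
  elim: x => [|x IH]; first by rewrite addn0 cu leq_addr.
  rewrite addnS cS; move: IH; rewrite leq_eqVlt => /orP[/eqP cE|]; last first.
    by case: (_ == _) => h; rewrite ?addn1// addn0 ltnW.
  have ux : (u <= u + x)%N by rewrite leq_addr.
  rewrite cE (_ : (A (u + x) == q) = false) ?addn0//; apply/negbTE.
  have cgex p : p \in tied -> p != q -> (N <= c (u + x) p)%N.
    by move=> pT pq; apply: leq_trans (cge p pT pq) (c_mono p ux).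
  apply: (@pushed_not_sampled (u + x) N K q C) => //.
  - by apply: good1; rewrite /= (leq_trans T1u).
  - by move=> p pT pq; apply: quiet => //; exact: cgex.
  - by rewrite /cur_mean cE.
  - by apply: HN1; rewrite /= (leq_trans _ NN)// leq_maxl.
have [x] := inf q qT (N + N).+1.
by rewrite leqNgt ltnS (leq_trans (c_mono q (leq_addl u x)))// bounded.
Qed.

End Limits.

Lemma path_consistency : \forall t \near \oo, b t = best.
Proof.
have [lim limP] := choice limit_count.
exact: (eventually_best limP).
Qed.

End Deterministic.

(** * Posterior means along a path *)

Section Paths.
Context d (T : measurableType d) (R : realType) (P : probability T R).
Context (k m : nat).
Local Notation E := ('I_k * 'I_m)%type.
Context (X : E * nat -> {RV P >-> R}) (mu sigma mu0 sigma0 : 'I_k -> 'I_m -> R).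
Hypothesis sigma_gt0 : forall i d, 0 < sigma i d.
Hypothesis sigma0_gt0 : forall i d, 0 < sigma0 i d.

Local Notation truth := (truth mu).
Local Notation noise := (noise sigma).
Local Notation pvar := (pvar sigma sigma0).
Local Notation pmean := (pmean X mu sigma mu0 sigma0).
Local Notation csum := (csum X truth).

Let noise_gt0 p : 0 < noise p. Proof. exact: sigma_gt0. Qed.

(** The weight of the prior in the deviation of the posterior mean, a constant
effect on the sum of the replications. *)
Definition prior_pull (p : E) : R := `|mu0 p.1 p.2 - truth p| / sigma0 p.1 p.2 ^+ 2.

Let prior_pull_ge0 p : 0 <= prior_pull p.
Proof. by rewrite /prior_pull divr_ge0// sqr_ge0. Qed.

Lemma pvar_le p n : (0 < n)%N -> pvar p n <= noise p ^+ 2 / n%:R.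
Proof.
move=> n0; rewrite /pvar /var_after -[leRHS]invrK invf_div.
rewrite lef_pV2 ?posrE ?ltr_wpDl ?divr_gt0 ?ltr0n ?exprn_gt0 ?invr_ge0 ?sqr_ge0//.
  by rewrite lerDr invr_ge0 sqr_ge0.
Qed.

Lemma pvar_ge p n : (0 < n)%N ->
  (n%:R * ((sigma0 p.1 p.2 ^+ 2)^-1 + (noise p ^+ 2)^-1))^-1 <= pvar p n.
Proof.
move=> n0; have s0 : 0 < sigma p.1 p.2 ^+ 2 by rewrite exprn_gt0.
have s00 : 0 < sigma0 p.1 p.2 ^+ 2 by rewrite exprn_gt0.
have nR : 0 < n%:R :> R by rewrite ltr0n.
rewrite /pvar /var_after lef_pV2 ?posrE.
- rewrite mulrDr lerD2r ler_peMl ?ler1n//; by rewrite invr_ge0 ltW.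
- by rewrite mulr_gt0// addr_gt0 ?invr_gt0.
- by rewrite addr_gt0 ?invr_gt0// divr_gt0.
Qed.

Lemma pmean_deviation p n w : pmean p n w - truth p =
  pvar p n * ((mu0 p.1 p.2 - truth p) / sigma0 p.1 p.2 ^+ 2 + csum p 0 n w / noise p ^+ 2).
Proof.
have v0 : 0 < pvar p n by exact: pvar_gt0.
have vE : pvar p n * ((sigma0 p.1 p.2 ^+ 2)^-1 + n%:R / noise p ^+ 2) = 1.
  by rewrite mulVf// -invr_eq0 gt_eqF.
rewrite /pmean -[X in _ - X]mulr1 -[X in _ - _ * X]vE.
by rewrite mulrCA -mulrBr; congr (_ * _); ring.
Qed.

Lemma pmean_deviation_le p n w : (0 < n)%N ->
  `|pmean p n w - truth p| <= noise p ^+ 2 * prior_pull p / n%:R + `|csum p 0 n w| / n%:R.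
Proof.
move=> n0; have nR : 0 < n%:R :> R by rewrite ltr0n.
have v0 : 0 < pvar p n by exact: pvar_gt0.
have s0 : 0 < noise p ^+ 2 by rewrite exprn_gt0.
rewrite pmean_deviation normrM (gtr0_norm v0).
apply: (@le_trans _ _ (noise p ^+ 2 / n%:R * (prior_pull p + `|csum p 0 n w| / noise p ^+ 2))).
  apply: ler_pM => //; [exact: ltW|exact: pvar_le|].
  apply: (le_trans (ler_normD _ _)).
  rewrite /prior_pull !normrM !normfV (gtr0_norm s0) [`|sigma0 _ _ ^+ 2|]ger0_norm ?sqr_ge0//.
rewrite le_eqVlt; apply/orP; left; apply/eqP; field.
by rewrite !gt_eqF.
Qed.

Lemma pmean_cvg p w : csum p 0 n w / n%:R @[n --> \oo] --> (0 : R) ->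
  pmean p n w @[n --> \oo] --> truth p.
Proof.
move=> sc; apply/cvgrPdist_le => e e0; have e2 : 0 < e / 2 by rewrite divr_gt0.
near=> n; have n0 : (0 < n)%N by near: n; exists 1%N.
have nR : 0 < n%:R :> R by rewrite ltr0n.
rewrite distrC (le_trans (pmean_deviation_le p w n0))// (splitr e) lerD//.
  rewrite ler_pdivrMr// -ler_pdivrMl//.
  near: n; exists (Num.truncn ((e / 2)^-1 * (noise p ^+ 2 * prior_pull p))).+1 => // n /= nle.
  by apply: (le_trans (ltW (truncnS_gt _))); rewrite ler_nat.
rewrite -[X in _ / X]gtr0_norm// -normf_div -normrN -[X in `|X|]add0r.
by near: n; move/cvgrPdist_le : sc; apply.
Unshelve. all: by end_near.
Qed.

(** The summand of q is what [pushed_mean] needs for that pair: it offsets the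
deviation of the first N replications and the pull of the prior, and it inverts
the lower bound of [pvar_ge] on the posterior variance at 2 N replications. The
sum makes one size serve for all pairs. *)
Definition push_size (K C : nat) : R := \sum_(q : E)
  (C%:R + noise q ^+ 2 * (prior_pull q +
     2 * ((sigma0 q.1 q.2 ^+ 2)^-1 + (noise q ^+ 2)^-1) *
     (C%:R + \sum_(p : E) noise p ^+ 2 * prior_pull p + K%:R))) / noise q.

Let summand_ge0 K C (q : E) : 0 <=
  (C%:R + noise q ^+ 2 * (prior_pull q +
     2 * ((sigma0 q.1 q.2 ^+ 2)^-1 + (noise q ^+ 2)^-1) *
     (C%:R + \sum_(p : E) noise p ^+ 2 * prior_pull p + K%:R))) / noise q.
Proof.
rewrite divr_ge0 ?(ltW (noise_gt0 q))// addr_ge0// mulr_ge0 ?sqr_ge0// addr_ge0//.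
rewrite mulr_ge0 ?mulr_ge0 ?addr_ge0 ?invr_ge0 ?sqr_ge0//.
by rewrite sumr_ge0// => p _; rewrite mulr_ge0 ?sqr_ge0.
Qed.

Lemma push_size_ge0 K C : 0 <= push_size K C.
Proof. by apply: sumr_ge0 => q _; exact: summand_ge0. Qed.

Lemma pushed_mean (s : R) q N K C w : (0 < N)%N -> s ^+ 2 = 1 ->
  `|csum q 0 N w| <= C%:R * N%:R / Num.sqrt N%:R ->
  push X truth noise s q N (push_size K C) w ->
  (C%:R + \sum_(p : E) noise p ^+ 2 * prior_pull p + K%:R) / Num.sqrt N%:R <=
    s * (pmean q (N + N) w - truth q).
Proof.
move=> N0 s1 quiet; rewrite /push/=.
set r := Num.sqrt N%:R; set C1 := C%:R + _ + _.
have NR : 0 < N%:R :> R by rewrite ltr0n.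
have r0 : 0 < r by rewrite sqrtr_gt0.
have rr : N%:R = r ^+ 2 by rewrite sqr_sqrtr// ler0n.
have r1 : 1 <= r by rewrite -sqrtr1 ler_wsqrtr// ler1n.
have s0 : 0 < noise q ^+ 2 by rewrite exprn_gt0.
have s00 : 0 < sigma0 q.1 q.2 ^+ 2 by rewrite exprn_gt0.
set h := (sigma0 q.1 q.2 ^+ 2)^-1 + (noise q ^+ 2)^-1.
have h0 : 0 < h by rewrite addr_gt0// invr_gt0.
have C10 : 0 <= C1.
  rewrite !addr_ge0// sumr_ge0// => p _; by rewrite mulr_ge0 ?sqr_ge0.
have absS x : - `|x| <= s * x.
  have : `|s| = 1 by move/eqP: s1; rewrite -sqrtr_sqr => /eqP ->; rewrite sqrtr1.
  by move=> ns; have := ler_norm (- (s * x)); rewrite normrN normrM ns mul1r; lra.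
set x := push_size K C => px.
have xq : (C%:R + noise q ^+ 2 * (prior_pull q + 2 * h * C1)) / noise q <= x.
  by rewrite /x /push_size (bigD1 q)//= lerDl sumr_ge0// => i _; exact: summand_ge0.
have s2N : (noise q ^+ 2 * (prior_pull q + 2 * h * C1)) * r <= s * csum q 0 (N + N) w.
  have -> : csum q 0 (N + N) w = csum q 0 N w + csum q N (N + N) w.
    by rewrite /csum -big_cat_nat//= leq_addr.
  have qN : `|csum q 0 N w| <= C%:R * r.
    have <- : C%:R * N%:R / r = C%:R * r by rewrite rr; field; rewrite gt_eqF.
    exact: quiet.
  have xr : (C%:R + noise q ^+ 2 * (prior_pull q + 2 * h * C1)) * r <= x * (noise q * r).
    by rewrite mulrA ler_pM2r// -ler_pdivrMr.
  have := absS (csum q 0 N w); rewrite mulrDr; move: xr; rewrite mulrDl; lra.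
rewrite pmean_deviation mulrCA.
set z := s * _.
have zr : (2 * h * C1) * r <= z.
  have h1 : - prior_pull q <= s * ((mu0 q.1 q.2 - truth q) / sigma0 q.1 q.2 ^+ 2).
    by apply: le_trans (absS _); rewrite normrM normfV [`|_ ^+ 2|]ger0_norm ?sqr_ge0.
  have zE : z = s * ((mu0 q.1 q.2 - truth q) / sigma0 q.1 q.2 ^+ 2) +
      s * (csum q 0 (N + N) w / noise q ^+ 2) by rewrite /z mulrDr.
  have h2 : prior_pull q * r + 2 * h * C1 * r <= s * (csum q 0 (N + N) w / noise q ^+ 2).
    rewrite -mulrDl; by rewrite mulrA ler_pdivlMr// [X in X <= _]mulrC mulrA.
  have h3 : prior_pull q <= prior_pull q * r by rewrite ler_peMr.
  by rewrite zE; lra.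
have NN0 : (0 < N + N)%N by rewrite addn_gt0 N0.
apply: (@le_trans _ _ (((N + N)%:R * h)^-1 * (2 * h * C1 * r))).
  rewrite natrD rr le_eqVlt; apply/orP; left; apply/eqP; field.
  by apply/and3P; split; rewrite gt_eqF// addr_gt0 ?exprn_gt0.
apply: ler_pM => //.
- by rewrite invr_ge0 mulr_ge0// ltW.
- by rewrite !mulr_ge0 ?(ltW h0) ?(ltW r0).
- exact: pvar_ge.
Qed.

Lemma quiet_mean p N n (C : nat) w : (0 < N)%N -> (N <= n)%N ->
  `|csum p 0 n w| <= C%:R * n%:R / Num.sqrt N%:R ->
  `|pmean p n w - truth p| <=
    (C%:R + \sum_(p : E) noise p ^+ 2 * prior_pull p) / Num.sqrt N%:R.
Proof.
move=> N0 Nn cs; have n0 : (0 < n)%N by exact: leq_trans Nn.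
have nR : 0 < n%:R :> R by rewrite ltr0n.
have NR : 0 < N%:R :> R by rewrite ltr0n.
have r0 : 0 < Num.sqrt N%:R :> R by rewrite sqrtr_gt0.
apply: (le_trans (pmean_deviation_le p w n0)); rewrite mulrDl addrC lerD//.
  by rewrite ler_pdivrMr// (le_trans cs)// mulrAC.
have pp0 q : 0 <= noise q ^+ 2 * prior_pull q by rewrite mulr_ge0 ?sqr_ge0.
apply: ler_pM => //.
  by rewrite (bigD1 p)//= lerDl sumr_ge0.
rewrite lef_pV2 ?posrE// (@le_trans _ _ N%:R) ?ler_nat//.
have r1 : 1 <= Num.sqrt N%:R :> R by rewrite -[X in X <= _]sqrtr1 ler_wsqrtr// ler1n.
by rewrite -[leRHS]sqr_sqrtr ?ler0n// expr2 ler_peMl ?(ltW r0).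
Qed.

End Paths.

(** * Consistency *)

Theorem theorem2
  (disp : measure_display) (T : measurableType disp) (R : realType)
  (P : probability T R)
  (k m n0 : nat) (hk : (2 <= k)%N) (hn0 : (1 <= n0)%N)
  (mu sigma mu0 sigma0 : 'I_k -> 'I_m -> R)
  (hsigma : forall i d, 0 < sigma i d)
  (hsigma0 : forall i d, 0 < sigma0 i d)
  (worst : 'I_k -> 'I_m) (best : 'I_k)
  (hworst : forall i d, d != worst i -> mu i (worst i) < mu i d)
  (hbest : forall j, j != best -> mu j (worst j) < mu best (worst best))
  (X : 'I_k * 'I_m * nat -> {RV P >-> R})
  (hXlaw : forall i d n (B : set R), measurable B ->
     distribution P (X ((i, d), n)) B = normal_prob (mu i d) (sigma i d) B)
  (hXindep : mutually_independent X)
  (A : nat -> T -> 'I_k * 'I_m)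
  (G : set (set T)) (hG : sigma_algebra setT G) (hGm : G `<=` measurable)
  (hXG : independent_of X G)
  (hA : nonanticipating X A G)
  (hinit : forall w p, count_rep A (n0 * (k * m)) w p = n0)
  (D : nat -> T -> 'I_k -> 'I_m) (b : nat -> T -> 'I_k)
  (hD : forall t w i d,
     post_mean X A mu0 sigma0 sigma t w i (D t w i)
       <= post_mean X A mu0 sigma0 sigma t w i d)
  (hb : forall t w i,
     post_mean X A mu0 sigma0 sigma t w i (D t w i)
       <= post_mean X A mu0 sigma0 sigma t w (b t w) (D t w (b t w)))
  (hraoda : forall t w, (n0 * (k * m) <= t)%N ->
     raoda_choice
       (post_mean X A mu0 sigma0 sigma t w)
       (post_var A sigma0 sigma t w)
       (next_var A sigma0 sigma t w)
       (D t w) (b t w) (A t w)) :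
  {ae P, forall w, \forall t \near \oo, b t w = best}.
Proof.
pose E : Type := ('I_k * 'I_m)%type.
have hlaw (p : E) n (B : set R) : measurable B ->
    distribution P (X (p, n)) B = normal_prob (truth mu p) (noise sigma p) B.
  by case: p => i d; exact: hXlaw.
have hnoise (p : E) : 0 < noise sigma p by exact: hsigma.
pose dir (q : E) : R := if q.1 == best then -1 else 1.
have dir2 q : dir q ^+ 2 = 1 by rewrite /dir; case: ifP; rewrite ?sqrrN expr1n.
pose size K := push_size mu sigma mu0 sigma0 K.
have size0 K C : 0 <= size K C by exact: push_size_ge0.
pose infinite_on (S : {set E}) w :=
  forall p, p \in S -> forall M, exists t, (M <= count_rep A t w p)%N.
(* The set of tied pairs and the margin vary with the path, but there are only
   countably many of them. *)
pose bad (i : {set E} * nat) : set T := [set w | (exists p, p \in i.1) /\ infinite_on i.1 w /\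
  forall C : nat, exists N0, forall N, (N0 <= N)%N -> (0 < N)%N -> forall q, q \in i.1 ->
    ~ (calm X (truth mu) A i.1 q N C%:R w /\
       push X (truth mu) (noise sigma) (dir q) q N (size i.2 C) w)].
have bad_null : P.-negligible (\bigcup_i bad i).
  apply: negligible_countable_bigcup => -[S K].
  have [[p pS]|nS] := pselect (exists p, p \in S); last first.
    by apply: negligibleS (negligible_set0 P) => w [/nS].
  have := push_recurrence hG hGm hXG hXindep hnoise hlaw hA pS dir2 (size0 K).
  by apply: negligibleS => w [_].
have lln : {ae P, forall w, forall p : E,
    csum X (truth mu) p 0 n w / n%:R @[n --> \oo] --> (0 : R)}.
  by apply: filter_forall => p; exact: (slln hG hGm hXG hXindep hnoise hlaw).
have no_ties : {ae P, forall w, untied X mu sigma mu0 sigma0 w}.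
  exact: (ae_untied mu0 hG hGm hXG hXindep hsigma hsigma0 hXlaw).
have notbad : {ae P, forall w, ~ (\bigcup_i bad i) w}.
  by apply: negligibleS bad_null => w /= /contrapT.
near=> w.
have w_lln : forall p : E, csum X (truth mu) p 0 n w / n%:R @[n --> \oo] --> (0 : R).
  by near: w.
have w_untied : untied X mu sigma mu0 sigma0 w by near: w.
have w_good : ~ (\bigcup_i bad i) w by near: w.
have post t i d : post_mean X A mu0 sigma0 sigma t w i d =
    cur_mean (fun p n => pmean X mu sigma mu0 sigma0 p n w)
      (fun t p => count_rep A t w p) t (i, d) by exact: post_meanE.
apply: (@path_consistency R k m (truth mu) (fun p n => pmean X mu sigma mu0 sigma0 p n w)
  (pvar sigma sigma0) (fun t p => count_rep A t w p) (A^~ w) (D^~ w) (b^~ w)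
  worst best (n0 * (k * m)) (\sum_(p : E) noise sigma p ^+ 2)).
- by move=> t p; exact: count_repS.
- by move=> t p tt; rewrite (leq_trans _ (count_rep_mono A w p tt))// hinit.
- by move=> p n; exact: pvar_gt0.
- by move=> p n; exact: pvar_decr.
- move=> p n np; apply: (@le_trans _ _ (noise sigma p ^+ 2 / n%:R)); first exact: pvar_le.
  by rewrite ler_wpM2r ?invr_ge0// (bigD1 p)//= lerDl sumr_ge0// => q _; exact: sqr_ge0.
- by move=> p; exact: pmean_cvg.
- exact: w_untied.
- by move=> t i d; rewrite -!post.
- by move=> t i; rewrite -!post.
- move=> t q e0 tt cq ed.
  have [e' ed' He'] := raoda_choice_edge (hraoda t w tt) cq ed.
  exists e' => // e ede; have := He' _ ede.
  have evE r f : edge_value (post_mean X A mu0 sigma0 sigma t w)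
      (post_var A sigma0 sigma t w) (next_var A sigma0 sigma t w) r f =
    edge_sep (fun p n => pmean X mu sigma mu0 sigma0 p n w) (pvar sigma sigma0)
      (fun t p => count_rep A t w p) t (Some r) f.
    rewrite /edge_value /edge_sep /separation !post; case: f => -[i d] [j l] /=; congr (_ / (_ + _)).
      rewrite /cur_var /pvar /next_var /post_var (_ : (Some r == Some (i, d)) = (r == (i, d)))//.
      by case: (r == _); rewrite ?addn1 ?addn0.
    rewrite /cur_var /pvar /next_var /post_var (_ : (Some r == Some (j, l)) = (r == (j, l)))//.
    by case: (r == _); rewrite ?addn1 ?addn0.
  by rewrite !evE.
- by move=> t tt; have [] := hraoda t w tt.
- move=> i d; rewrite /truth /=; have [->//|ne] := eqVneq d (worst i).
  exact/ltW/hworst.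
- by move=> j jb; exact: hbest.
- move=> S K [p pS] infS.
  have [C HC] : exists C : nat, forall N0, exists N q, [/\ (N0 <= N)%N, (0 < N)%N, q \in S,
      calm X (truth mu) A S q N C%:R w &
      push X (truth mu) (noise sigma) (dir q) q N (size K C) w].
    apply: contrapT => nC; apply: w_good; exists (S, K) => //; split; first by exists p.
    split=> // C; apply: contrapT => nN; apply: nC; exists C => N0.
    apply: contrapT => nq; apply: nN; exists N0 => N NN N1 q qS [cq pq].
    by apply: nq; exists N, q.
  (* The prior adds its pull to the constant C that bounds the sums. *)
  exists (C%:R + \sum_(p : E) noise sigma p ^+ 2 * prior_pull mu mu0 sigma0 p).
  move=> N0; have [N [q [NN N1 qS [[[t [cq others]] qq] quiet] pq]]] := HC N0.
  exists N, q, t; split => //; split => //.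
  + move=> p' n' pS' pq' Nn; have := quiet p' I; rewrite pS' pq' => /(_ _ Nn).
    exact: quiet_mean.
  + exact: (pushed_mean hsigma hsigma0 N1 (dir2 q) qq pq).
Unshelve. all: by end_near.
Qed.
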